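(* Let $G\le\mathrm{Aut}(T)$ be a finitely generated branch group. Let $X$ be a compact space and $H\le\mathrm{Homeo}(X)$ a finitely generated group such that $d:=\sup_{x\in X}\mathrm{leud}(\widetilde{\Gamma}(H,x))$ is finite. Let $\rho:G\to H$ be an injective homomorphism and let $Y\subset X$ be the essential support of the $G$-action on $X$ induced by $\rho$. Then there exists an upper semi-continuous $G$-equivariant map $q:Y\to\partial T^{[d]}$. Moreover, if $d=1$, then the map $q:Y\to\partial T^{[1]}=\partial T$ is continuous.
   Context: $T$ is an infinite locally finite rooted tree, $\mathrm{Aut}(T)$ its root-fixing automorphisms, $\partial T$ its boundary. $\mathrm{Rist}_G(v)$ is the set of elements of $G$ acting trivially outside the subtree below vertex $v$, $\mathrm{Rist}_G(n)$ the subgroup generated by $\mathrm{Rist}_G(v)$ for $v$ at level $n$, $K'$ the derived subgroup. $G$ is a branch group if it is transitive on each level and $\mathrm{Rist}_G(n)$ has finite index in $G$ for all $n\ge1$. For a group $K$ acting on $X$, $\mathrm{supp}_X(K)$ is the closure of the set of points not fixed by $K$; the essential support of the $G$-action is $Y=\bigcap_{n\ge1}\mathrm{supp}_X(\mathrm{Rist}_G(n)')$. For $x\in X$, $H^0_x$ is the set of elements of $H$ acting trivially on a neighbourhood of $x$; fixing a finite symmetric generating set $S$ of $H$, the graph of germs $\widetilde{\Gamma}(H,x)$ has vertex set $H/H^0_x$ and an edge from $gH^0_x$ to $sgH^0_x$ for each $s\in S$. For a bounded degree graph $\Gamma$, $\mathrm{leud}(\Gamma)\in[0,\infty]$ is the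 supremum of all $d$ such that there exists a Lipschitz map $\mathbb{N}^d\to\Gamma$ whose fibres have uniformly bounded cardinality. For a compact space $Z$, $Z^{[d]}$ is the subspace of the space $\mathcal{F}(Z)$ of closed subsets (Hausdorff topology) consisting of non-empty sets of cardinality at most $d$. A map $q:Y\to\mathcal{F}(Z)$ is upper semi-continuous if for every compact (closed) $K\subseteq Z$ the set $\{y:q(y)\cap K=\varnothing\}$ is open. *)

(* Defs.v *)
From HB Require Import structures.
From mathcomp Require Import all_boot.
From mathcomp Require Import boolp classical_sets topology.
From Stdlib Require List.
Set Implicit Arguments. Unset Strict Implicit. Unset Printing Implicit Defensive.
Local Open Scope classical_set_scope.

Section Groups.
Variable U : Type.

Definition is_inv (g h : U -> U) := h \o g = id /\ g \o h = id.

Definition is_subgroup (K : set (U -> U)) :=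
  K id /\ (forall g h, K g -> K h -> K (g \o h)) /\
  (forall g, K g -> exists h, K h /\ is_inv g h).

Inductive gen (A : set (U -> U)) : set (U -> U) :=
  | gen_id : gen A id
  | gen_base g : A g -> gen A g
  | gen_mul g h : gen A g -> gen A h -> gen A (g \o h)
  | gen_inv g h : gen A g -> is_inv g h -> gen A h.

Definition generates (K : set (U -> U)) (S : list (U -> U)) :=
  (forall s, List.In s S -> K s) /\ (forall g, K g -> gen (fun s => List.In s S) g).

Definition fin_gen (K : set (U -> U)) := is_subgroup K /\ exists S, generates K S.

Definition fin_sym_gen (K : set (U -> U)) (S : list (U -> U)) :=
  generates K S /\ (forall s, List.In s S -> exists t, List.In t S /\ is_inv s t).

Definition commutators (K : set (U -> U)) : set (U -> U) :=
  [set c | exists g h gi hi, K g /\ K h /\ is_inv g gi /\ is_inv h hi /\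
                             c = gi \o hi \o g \o h].

Definition derived (K : set (U -> U)) := gen (commutators K).

Definition finite_index (K G : set (U -> U)) :=
  exists reps : list (U -> U), (forall r, List.In r reps -> G r) /\
    forall g, G g -> exists r k, List.In r reps /\ K k /\ g = r \o k.
End Groups.

(* ---------- rooted trees: vertices are finite words, root = [::],
   the children of v are the words rcons v i lying in the tree ---------- *)
Definition is_rooted_tree (Tv : set (seq nat)) :=
  Tv [::] /\ (forall v i, Tv (rcons v i) -> Tv v).

Definition locally_finite (Tv : set (seq nat)) :=
  forall v, Tv v -> exists b, forall i, Tv (rcons v i) -> (i < b)%N.

Definition infinite_tree (Tv : set (seq nat)) :=
  ~ exists s : seq (seq nat), forall v, Tv v -> v \in s.

Definition adj (u w : seq nat) :=
  (exists i, w = rcons u i) \/ (exists i, u = rcons w i).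

(* root-fixing automorphism of T (extended by the identity off the tree) *)
Definition is_tree_aut (Tv : set (seq nat)) (g : seq nat -> seq nat) :=
  (forall v, ~ Tv v -> g v = v) /\ (forall v, Tv v -> Tv (g v)) /\
  bijective g /\ g [::] = [::] /\
  (forall u w, Tv u -> Tv w -> (adj u w <-> adj (g u) (g w))).

Definition rist (Tv : set (seq nat)) (G : set (seq nat -> seq nat)) (v : seq nat) :=
  [set g | G g /\ forall w, Tv w -> ~~ prefix v w -> g w = w].

Definition rist_level (Tv : set (seq nat)) (G : set (seq nat -> seq nat)) (n : nat) :=
  gen [set g | exists v, Tv v /\ size v = n /\ rist Tv G v g].

Definition level_transitive (Tv : set (seq nat)) (G : set (seq nat -> seq nat)) :=
  forall u w, Tv u -> Tv w -> size u = size w -> exists g, G g /\ g u = w.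

Definition is_branch (Tv : set (seq nat)) (G : set (seq nat -> seq nat)) :=
  is_subgroup G /\ (forall g, G g -> is_tree_aut Tv g) /\
  level_transitive Tv G /\
  (forall n, (0 < n)%N -> finite_index (rist_level Tv G n) G).

Definition is_ray (Tv : set (seq nat)) (xi : nat -> nat) := forall n, Tv (mkseq xi n).

Definition ray_act (g : seq nat -> seq nat) (xi : nat -> nat) : nat -> nat :=
  fun n => nth 0%N (g (mkseq xi n.+1)) n.

Definition bd_closed (Tv : set (seq nat)) (K : set (nat -> nat)) :=
  (forall xi, K xi -> is_ray Tv xi) /\
  (forall xi, is_ray Tv xi -> ~ K xi ->
     exists n, forall eta, K eta -> mkseq eta n <> mkseq xi n).

Definition in_bd_pow (Tv : set (seq nat)) (d : nat) (A : set (nat -> nat)) :=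
  exists l : list (nat -> nat), (0 < size l)%N /\ (size l <= d)%N /\
    (forall xi, List.In xi l -> is_ray Tv xi) /\ A = [set xi | List.In xi l].

Section Space.
Variable X : topologicalType.

Definition is_homeo_group (H : set (X -> X)) :=
  is_subgroup H /\ (forall h, H h -> continuous h).

Definition supp_X (K : set (X -> X)) : set X :=
  closure [set x | exists k, K k /\ k x <> x].

Definition ess_supp (Tv : set (seq nat)) (G : set (seq nat -> seq nat))
  (rho : (seq nat -> seq nat) -> (X -> X)) : set X :=
  [set x | forall n, (0 < n)%N -> supp_X (rho @` derived (rist_level Tv G n)) x].

Definition H0 (H : set (X -> X)) (x : X) : set (X -> X) :=
  [set h | H h /\ \forall z \near x, h z = z].

Definition same_coset (H : set (X -> X)) (x : X) (g h : X -> X) :=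
  exists hi, H hi /\ is_inv h hi /\ H0 H x (hi \o g).

Definition apply_word (w : list (X -> X)) (g : X -> X) :=
  foldl (fun acc s => s \o acc) g w.

(* distance in the graph of germs between gH^0_x and hH^0_x is at most k *)
Definition germ_dist_le (H : set (X -> X)) (S : list (X -> X)) (x : X)
  (g h : X -> X) (k : nat) :=
  exists w : list (X -> X), (forall s, List.In s w -> List.In s S) /\
    (size w <= k)%N /\ same_coset H x (apply_word w g) h.

Definition l1dist (d : nat) (p q : d.-tuple nat) : nat :=
  \sum_(i < d) ((tnth p i - tnth q i) + (tnth q i - tnth p i)).

(* there is a Lipschitz map N^d -> graph of germs at x with uniformly bounded fibres *)
Definition leud_admits (H : set (X -> X)) (S : list (X -> X)) (x : X) (d : nat) :=
  exists f : d.-tuple nat -> (X -> X),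
    (forall p, H (f p)) /\
    (exists L, forall p q, germ_dist_le H S x (f p) (f q) (L * l1dist p q)) /\
    (exists C, forall h, H h -> forall s : seq (d.-tuple nat), uniq s ->
        (forall p, p \in s -> same_coset H x (f p) h) -> (size s <= C)%N).

Definition sup_leud_eq (H : set (X -> X)) (S : list (X -> X)) (d : nat) :=
  (forall x d', leud_admits H S x d' -> (d' <= d)%N) /\
  (forall b, (forall x d', leud_admits H S x d' -> (d' <= b)%N) -> (d <= b)%N).

Definition open_in (Y A : set X) := exists O, open O /\ A = O `&` Y.

Definition usc (Tv : set (seq nat)) (Y : set X) (q : X -> set (nat -> nat)) :=
  forall K, bd_closed Tv K -> open_in Y [set y | Y y /\ q y `&` K = set0].

(* continuity of a (singleton-valued) q : Y -> boundary *)
Definition cont_bd (Y : set X) (q : X -> set (nat -> nat)) :=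
  forall y xi n, Y y -> q y xi ->
    exists O, open O /\ O y /\
      forall y' xi', O y' -> Y y' -> q y' xi' -> mkseq xi' n = mkseq xi n.
End Space.

(* Main.v *)
Require Import Defs.
From HB Require Import structures.
From mathcomp Require Import all_boot.
From mathcomp Require Import boolp classical_sets topology.
From Stdlib Require List.
Local Open Scope classical_set_scope.
Set Implicit Arguments. Unset Strict Implicit. Unset Printing Implicit Defensive.

(** For [y] in the essential support let [q y] be the set of rays [xi] such that [y] lies in the
    support of Rist(xi|n)' for every [n].  It is upper semi-continuous and equivariant by
    construction, and non-empty by Koenig's lemma because Rist(n) is the product of the Rist(v)
    with [v] of level [n].

    Suppose [q y] contains [k] rays, passing through distinct vertices v_1, ..., v_k of some level.
    The groups R_i := Rist(v_i) commute and are finitely generated.  Let [L] be the stabilizer of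
    the germ at [y], and P_i the set of [a] in R_i such that [a c] lies in [L] for some [c]
    centralizing R_i.  If every P_i has infinite index in R_i, then the product of geodesic rays in
    the Schreier graphs R_i / P_i gives a Lipschitz injection of N^k into the graph of germs, whence
    k <= d.

    Suppose P_i has finite index; its core [N] is finitely generated, so there is one neighbourhood
    [V] of [y] on which each [p] in [N] acts as the inverse of an element centralizing R_i.  If some
    element of [L] in R_i moves the ray [xi], the double commutator trick, applied twice, shows that
    Rist(xi|m)' acts trivially near [y] for some [m], contradicting the choice of [xi].  Otherwise
    the elements of [L] in R_i fix the infinite set P_i xi pointwise, and d + 1 of its points give
    d + 1 commuting rigid stabilizers which produce a Lipschitz injection of N^(d+1). *)

(** * List membership and finite choice *)

Lemma InP (T : eqType) (x : T) (s : seq T) : List.In x s <-> x \in s.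
Proof.
elim: s => [|a s IH] //=; rewrite inE; split.
  by case=> [->|/IH ->]; rewrite ?eqxx ?orbT.
by case/orP => [/eqP ->|/IH]; [left|right].
Qed.

(** A finite form of choice. The last clause lets every listed witness inherit its properties from
    some index, so that the list contains nothing foreign. *)
Lemma finite_collect (I T : Type) (R : I -> T -> Prop) (s : seq I) :
  (forall i, List.In i s -> exists t, R i t) ->
  exists u : seq T, (forall i, List.In i s -> exists t, List.In t u /\ R i t) /\
    forall t, List.In t u -> exists i, List.In i s /\ R i t.
Proof.
elim: s => [|a s IH] h; first by exists [::]; split.
have [u [hu1 hu2]] := IH (fun i hi => h i (or_intror hi)).
have [t ht] := h a (or_introl erefl).
exists (t :: u); split.
  move=> i [<-|/hu1 [t' [h1 h2]]]; first by exists t; split; [left|].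
  by exists t'; split; [right|].
move=> t' [<-|/hu2 [i [h1 h2]]]; first by exists a; split; [left|].
by exists i; split; [right|].
Qed.

(** * Subgroups, finite index and commutators *)

Section GroupTheory.
Variable U : choiceType.
Implicit Types (K N R Q : set (U -> U)) (g h : U -> U).

(** A total inverse with default value [id]; it is meaningful only under [invertible g]. *)
Definition inv g : U -> U := @xget (U -> U) id [set h | is_inv g h].

Lemma is_inv_uniq g h k : is_inv g h -> is_inv g k -> h = k.
Proof.
move=> [h1 h2] [k1 k2]; apply: funext => x.
have e : g (k x) = x := congr1 (fun f => f x) k2.
have e2 : h (g (k x)) = k x := congr1 (fun f => f (k x)) h1.
by rewrite -e2 e.
Qed.

Lemma inv_eq g h : is_inv g h -> inv g = h.
Proof.
move=> gh; apply: is_inv_uniq (gh).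
by apply: (@xgetPex (U -> U) id [set h | is_inv g h]); exists h.
Qed.

Definition invertible g := is_inv g (inv g).

Lemma invertibleP g : (exists h, is_inv g h) -> invertible g.
Proof. by move=> [h gh]; rewrite /invertible (inv_eq gh). Qed.

Lemma invK1 g : invertible g -> cancel g (inv g).
Proof. by case=> h _ x; rewrite -[LHS]/((inv g \o g) x) h. Qed.

Lemma invK2 g : invertible g -> cancel (inv g) g.
Proof. by case=> _ h x; rewrite -[LHS]/((g \o inv g) x) h. Qed.

Lemma is_invP g h : cancel g h -> cancel h g -> is_inv g h.
Proof. by move=> h1 h2; split; apply: funext. Qed.

Lemma invertible_id : invertible id.
Proof. by apply: invertibleP; exists id. Qed.

Lemma inv_id : inv id = id.
Proof. exact: inv_eq. Qed.

Lemma is_inv_comp g h gi hi : is_inv g gi -> is_inv h hi -> is_inv (g \o h) (hi \o gi).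
Proof.
move=> /[dup] /inv_eq <- G /[dup] /inv_eq <- Hh; apply: is_invP => x /=.
  by rewrite (invK1 G) (invK1 Hh).
by rewrite (invK2 Hh) (invK2 G).
Qed.

Lemma invM g h : invertible g -> invertible h -> inv (g \o h) = inv h \o inv g.
Proof. by move=> G Hh; apply: inv_eq; apply: is_inv_comp. Qed.

Lemma invertible_comp g h : invertible g -> invertible h -> invertible (g \o h).
Proof. by move=> G Hh; apply: invertibleP; eexists; apply: is_inv_comp G Hh. Qed.

Lemma invertible_inv g : invertible g -> invertible (inv g).
Proof. by move=> G; apply: invertibleP; exists g; case: G. Qed.

Lemma invI g : invertible g -> inv (inv g) = g.
Proof. by move=> G; apply: inv_eq; case: G. Qed.

Lemma subgroup_id K : is_subgroup K -> K id. Proof. by case. Qed.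

Lemma subgroupM K g h : is_subgroup K -> K g -> K h -> K (g \o h).
Proof. by move=> [_ [h1 _]]; apply: h1. Qed.

Lemma subgroup_invertible K g : is_subgroup K -> K g -> invertible g.
Proof. by move=> [_ [_ h]] /h [k [_ ?]]; apply: invertibleP; exists k. Qed.

Lemma subgroupV K g : is_subgroup K -> K g -> K (inv g).
Proof. by move=> [_ [_ h]] /h [k [? /inv_eq ->]]. Qed.

Lemma subgroupP K : K id -> (forall g h, K g -> K h -> K (g \o h)) ->
  (forall g, K g -> invertible g) -> (forall g, K g -> K (inv g)) -> is_subgroup K.
Proof. by move=> h1 h2 h3 h4; split=> //; split=> // g Kg; exists (inv g); split; [apply: h4|apply: h3]. Qed.

Lemma subgroupVl K g h : is_subgroup K -> K g -> K h -> K (inv g \o h).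
Proof. by move=> hK Kg Kh; apply: subgroupM => //; apply: subgroupV. Qed.

Lemma gen_min (A : set (U -> U)) K : is_subgroup K -> A `<=` K -> gen A `<=` K.
Proof.
move=> hK sAK g; elim=> {g} [|g /sAK //|g h _ Kg _ Kh|g h _ Kg /inv_eq <-].
- exact: subgroup_id.
- exact: subgroupM.
- exact: subgroupV.
Qed.

Lemma gen_invertible (A : set (U -> U)) g :
  (forall a, A a -> invertible a) -> gen A g -> invertible g.
Proof.
move=> hA; elim=> {g} [|g /hA //|g h _ Kg _ Kh|g h _ Kg /inv_eq <-].
- exact: invertible_id.
- exact: invertible_comp.
- exact: invertible_inv.
Qed.

Lemma gen_subgroup (A : set (U -> U)) :
  (forall a, A a -> invertible a) -> is_subgroup (gen A).
Proof.
move=> hA; apply: subgroupP => [|g h|g|g Ag].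
- exact: gen_id.
- exact: gen_mul.
- exact: gen_invertible.
- by apply: (gen_inv Ag); apply: gen_invertible Ag.
Qed.

Lemma gen_mono (A B : set (U -> U)) : A `<=` B -> gen A `<=` gen B.
Proof.
move=> sAB g; elim=> {g} [|g /sAB h|g h _ Kg _ Kh|g h _ Kg gh].
- exact: gen_id.
- exact: gen_base.
- exact: gen_mul.
- exact: gen_inv gh.
Qed.

(** * Commutators, derived subgroups and conjugation *)

Definition comm g h := inv g \o inv h \o g \o h.

Lemma commutatorsP K : is_subgroup K ->
  commutators K = [set c | exists g h, [/\ K g, K h & c = comm g h]].
Proof.
move=> hK; apply/seteqP; split => c.
  by move=> [g [h [gi [hi [Kg [Kh [/inv_eq <- [/inv_eq <- ->]]]]]]]]; exists g, h.
move=> [g [h [Kg Kh ->]]]; exists g, h, (inv g), (inv h).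
have ig := subgroup_invertible hK Kg; have ih := subgroup_invertible hK Kh.
by split=> //; split=> //; split.
Qed.

Lemma comm_subgroup K g h : is_subgroup K -> K g -> K h -> K (comm g h).
Proof. by move=> hK Kg Kh; do !apply: subgroupM => //; apply: subgroupV. Qed.

Lemma derived_comm K g h : is_subgroup K -> K g -> K h -> derived K (comm g h).
Proof. by move=> hK Kg Kh; apply: gen_base; rewrite commutatorsP //; exists g, h. Qed.

Lemma derived_sub_of K Q : is_subgroup K -> is_subgroup Q ->
  (forall g h, K g -> K h -> Q (comm g h)) -> derived K `<=` Q.
Proof.
move=> hK hQ h; apply: gen_min => // c; rewrite commutatorsP // => -[a [b [Ka Kb ->]]].
exact: h.
Qed.

Lemma derived_sub K : is_subgroup K -> derived K `<=` K.
Proof. by move=> hK; apply: derived_sub_of => // g h; apply: comm_subgroup. Qed.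

Lemma derived_subgroup K : is_subgroup K -> is_subgroup (derived K).
Proof.
move=> hK; apply: gen_subgroup => c; rewrite commutatorsP // => -[a [b [Ka Kb ->]]].
exact: (subgroup_invertible hK (comm_subgroup hK Ka Kb)).
Qed.

Lemma derived_mono K Q : K `<=` Q -> derived K `<=` derived Q.
Proof.
move=> sKQ; apply: gen_mono => c [g [h [gi [hi [Kg [Kh r]]]]]].
by exists g, h, gi, hi; split; [|split]; [apply: sKQ| apply: sKQ|].
Qed.

Definition conj_by a g := inv a \o g \o a.

Lemma conj_byM a g h : invertible a -> conj_by a (g \o h) = conj_by a g \o conj_by a h.
Proof. by move=> ia; apply: funext => x; rewrite /conj_by /= (invK2 ia). Qed.

Lemma conj_byV a g : invertible a -> invertible g -> conj_by a (inv g) = inv (conj_by a g).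
Proof.
move=> ia ig; symmetry; apply: inv_eq; apply: is_invP => x; rewrite /conj_by /=.
  by rewrite (invK2 ia) (invK1 ig) (invK1 ia).
by rewrite (invK2 ia) (invK2 ig) (invK1 ia).
Qed.

Lemma conj_by_comm a g h : invertible a -> invertible g -> invertible h ->
  conj_by a (comm g h) = comm (conj_by a g) (conj_by a h).
Proof.
move=> ia ig ih; rewrite /comm (@conj_byM a _ h) // (@conj_byM a _ g) //.
by rewrite (@conj_byM a (inv g)) // (@conj_byV a g) // (@conj_byV a h).
Qed.

Lemma conj_by1 a : invertible a -> conj_by a id = id.
Proof. by move=> ia; apply: funext => x; rewrite /conj_by /= (invK1 ia). Qed.

Lemma subgroup_conj K a g : is_subgroup K -> K a -> K g -> K (conj_by a g).
Proof. by move=> hK Ka Kg; do !apply: subgroupM => //; apply: subgroupV. Qed.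

Definition normalizes (B K : set (U -> U)) := forall b m, B b -> K m -> K (conj_by b m).

(** Source and target differ because conjugation by a tree automorphism carries the rigid stabilizer
    of one vertex to that of another. *)
Lemma derived_conj b K Q : invertible b -> is_subgroup K -> is_subgroup Q ->
  (forall g, K g -> Q (conj_by b g)) -> forall g, derived K g -> derived Q (conj_by b g).
Proof.
move=> ib hK hQ KQ; have hd := derived_subgroup hQ.
have hi g : derived K g -> invertible g by apply: subgroup_invertible (derived_subgroup hK).
have iK g : K g -> invertible g by apply: subgroup_invertible.
move=> g; elim=> {g} [|m|g h Dg Qg _ Qh|g h Dg Qg /inv_eq <-].
- by rewrite conj_by1 //; apply: subgroup_id.
- rewrite commutatorsP // => -[a [c [Qa Qc ->]]].
  rewrite (conj_by_comm ib (iK _ Qa) (iK _ Qc)).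
  by apply: derived_comm => //; apply: KQ.
- by rewrite conj_byM //; apply: subgroupM.
- by rewrite conj_byV //; [apply: subgroupV|apply: hi].
Qed.

Lemma derived_normalizes B Q : is_subgroup B -> is_subgroup Q ->
  normalizes B Q -> normalizes B (derived Q).
Proof.
move=> hB hQ nBQ b m Bb; apply: (derived_conj _ hQ hQ); first exact: subgroup_invertible Bb.
by move=> g Qg; apply: nBQ.
Qed.

(** * Finite index, normal cores and Schreier generators *)

Lemma subgroupI K Q : is_subgroup K -> is_subgroup Q -> is_subgroup (K `&` Q).
Proof.
move=> hK hQ; apply: subgroupP => [|g h [] ? ? [] ? ?|g [] ? ?|g [] ? ?].
- by split; apply: subgroup_id.
- by split; apply: subgroupM.
- by apply: subgroup_invertible hK _.
- by split; apply: subgroupV.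
Qed.

(** One representative is chosen for each colour of [f], with [id] for a colour that is not
    attained. Together with the converse below, this reduces finite index to finite colourings whose
    classes lie in cosets. *)
Lemma finite_index_of_invariant (F : finType) (f : (U -> U) -> F) N R : is_subgroup R ->
  (forall g h, R g -> R h -> f g = f h -> N (inv g \o h)) -> finite_index N R.
Proof.
move=> hR hf.
have hc i : List.In i (enum F) ->
    exists g, R g /\ forall h, R h -> f h = i -> f g = i.
  move=> _; have [[h [Rh hi]]|n] := pselect (exists h, R h /\ f h = i).
    by exists h; split.
  by exists id; split=> [|h Rh fh]; [apply: subgroup_id|case: n; exists h].
have [u [u1 u2]] := finite_collect hc.
exists u; split; first by move=> r /u2 [i [_ []]].
move=> g Rg; have [|r [ur [Rr]]] := u1 (f g); first by apply/InP; rewrite mem_enum.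
move=> /(_ g Rg erefl) e; exists r, (inv r \o g); split=> //; split; first exact: hf.
by apply: funext => x /=; rewrite (invK2 (subgroup_invertible hR Rr)).
Qed.

Lemma finite_index_invariant K R : is_subgroup K -> is_subgroup R -> K `<=` R ->
  finite_index K R ->
  exists n (f : (U -> U) -> 'I_n), forall g h, R g -> R h -> f g = f h -> K (inv g \o h).
Proof.
move=> hK hR sKR [s [s1 s2]].
(* The colour of [g] is the position of the first representative in its coset. The extra value
   [size s] stands for no representative and does not occur on [R]. *)
exists (size s).+1, (fun g => inord (find (fun r => `[< K (inv r \o g) >]) s)).
move=> g h Rg Rh.
have has_s g' : R g' -> has (fun r => `[< K (inv r \o g') >]) s.
  move=> /s2 [r [k [/InP rs [Kk ->]]]]; apply/hasP; exists r => //; apply/asboolP.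
  suff -> : inv r \o (r \o k) = k by [].
  by apply: funext => x /=; rewrite (invK1 (subgroup_invertible hR (s1 r _))) //; apply/InP.
have lt g' : R g' -> find (fun r => `[< K (inv r \o g') >]) s < size s.
  by move/has_s; rewrite has_find.
move/(congr1 (@nat_of_ord _)); rewrite !inordK ?ltnS ?find_size // => e.
have := nth_find id (has_s _ Rg); have := nth_find id (has_s _ Rh).
rewrite -e; set r := nth _ _ _ => /asboolP Kh /asboolP Kg.
have Rr : R r by apply: s1; apply/InP; rewrite mem_nth // lt.
have ir := subgroup_invertible hR Rr; have ig := subgroup_invertible hR Rg.
suff -> : inv g \o h = inv (inv r \o g) \o (inv r \o h) by apply: subgroupVl.
rewrite (invM (invertible_inv ir) ig) (invI ir).
by apply: funext => x /=; rewrite (invK2 ir).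
Qed.

Lemma finite_indexI K R Q : is_subgroup K -> is_subgroup R -> is_subgroup Q ->
  K `<=` R -> Q `<=` R -> finite_index K R -> finite_index (K `&` Q) Q.
Proof.
move=> hK hR hQ sKR sQR /(finite_index_invariant hK hR sKR) [n [f hf]].
apply: (@finite_index_of_invariant _ f) => // g h Qg Qh e.
by split; [apply: hf => //; apply: sQR|apply: subgroupVl].
Qed.

Lemma finite_index_core K R : is_subgroup K -> is_subgroup R -> K `<=` R ->
  finite_index K R ->
  exists N, [/\ is_subgroup N, N `<=` K, normalizes R N & finite_index N R].
Proof.
move=> hK hR sKR /[dup] fi /(finite_index_invariant hK hR sKR) [n [f hf]].
have iR g : R g -> invertible g by apply: subgroup_invertible.
exists [set m | R m /\ forall g, R g -> K (conj_by g m)]; split.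
- apply: subgroupP => [|g h [Rg Kg] [Rh Kh]|g [/iR]//|g [Rg Kg]].
  + by split=> [|g Rg]; [|rewrite (conj_by1 (iR _ Rg))]; apply: subgroup_id.
  + split=> [|k Rk]; first exact: subgroupM.
    by rewrite (conj_byM _ _ (iR _ Rk)); apply: subgroupM => //; [apply: Kg|apply: Kh].
  + split=> [|k Rk]; first exact: subgroupV.
    by rewrite (conj_byV (iR _ Rk) (iR _ Rg)); apply: subgroupV => //; apply: Kg.
- move=> m [Rm /(_ id (subgroup_id hR))]; rewrite /conj_by inv_id.
  by have -> : id \o m \o id = m by [].
- move=> b m Rb [Rm Km]; split; first exact: subgroup_conj.
  move=> g Rg; have := Km _ (subgroupM hR Rb Rg).
  by rewrite /conj_by (invM (iR _ Rb) (iR _ Rg)).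
case: fi => s [s1 s2].
(* The colour of [g] records the cosets of all products [g \o r] with [r] a representative. Equal
   colours put each conjugate of [inv g \o h] by [r] into [K], and a further conjugation by [k] in
   [K] reaches every element [r \o k] of [R]. *)
pose F := {ffun 'I_(size s) -> 'I_n}.
apply: (@finite_index_of_invariant F (fun g => [ffun i : 'I_(size s) => f (g \o nth id s i)])) => //.
move=> g h Rg Rh /ffunP e; split; first exact: subgroupVl.
move=> _ /s2 [r [k [rs [Kk ->]]]]; have Rr := s1 _ rs.
have Rk := sKR _ Kk.
move/InP: rs => rs; have := e (Ordinal (etrans (index_mem _ _) rs)).
rewrite !ffunE /= nth_index // => /hf Kx.
have := subgroup_conj hK Kk (Kx (subgroupM hR Rg Rr) (subgroupM hR Rh Rr)).
rewrite /conj_by (invM (iR _ Rg) (iR _ Rr)) (invM (iR _ Rr) (iR _ Rk)); exact.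
Qed.

Definition finitely_generated K := exists s : seq (U -> U), generates K s.

(** Schreier's lemma. The list [u] collects the factors in [K] of the products of a letter and a
    representative; [id] is added on both sides so that [id] itself gets such a factor. As the coset
    [K] may be represented by an element other than [id], the list [v] adds the representatives
    lying in [K]. *)
Lemma finitely_generated_finite_index K R : is_subgroup K -> is_subgroup R -> K `<=` R ->
  finite_index K R -> finitely_generated R -> finitely_generated K.
Proof.
move=> hK hR sKR [s [s1 s2]] [t [t1 t2]].
have iR g : R g -> invertible g by apply: subgroup_invertible.
pose t' := (t ++ map inv t)%list.
have t'R g : List.In g t' -> R g.
  rewrite /t' List.in_app_iff => -[/t1//|/List.in_map_iff [a [<- /t1]]].
  exact: subgroupV.
have hu ab : List.In ab (List.list_prod (id :: t') (id :: s)) ->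
    exists k, K k /\ exists r, List.In r s /\ ab.1 \o ab.2 = r \o k.
  case: ab => a b /List.in_prod_iff /= [ha hb].
  have Ra : R a by case: ha => [<-|/t'R//]; apply: subgroup_id.
  have Rb : R b by case: hb => [<-|/s1//]; apply: subgroup_id.
  by have [r [k [rs [Kk e]]]] := s2 _ (subgroupM hR Ra Rb); exists k; split=> //; exists r.
have hv r : List.In r s -> exists k, K k /\ (K r -> k = r).
  move=> rs; have [Kr|nKr] := pselect (K r); first by exists r.
  by exists id; split=> //; apply: subgroup_id.
have [u [u1 u2]] := finite_collect hu.
have [v [v1 v2]] := finite_collect hv.
have uK k : List.In k u -> K k by move=> /u2 [i [_ []]].
have vK k : List.In k v -> K k by move=> /v2 [i [_ []]].
exists (u ++ v)%list; split.
  by move=> k; rewrite List.in_app_iff => -[/uK|/vK].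
pose Q := gen (fun g => List.In g (u ++ v)%list).
have Qu k : List.In k u -> Q k by move=> h; apply: gen_base; apply/List.in_app_iff; left.
have Qv k : List.In k v -> Q k by move=> h; apply: gen_base; apply/List.in_app_iff; right.
(* This set contains [id] and is stable under left multiplication by [R], so every element of [R] is
   a representative times an element of [Q]. *)
pose D := [set g | exists r k, List.In r s /\ Q k /\ g = r \o k].
have Did : D id.
  have [|k [uk [_ [r [rs /= e]]]]] := u1 (id, id).
    by apply/List.in_prod_iff; split; left.
  by exists r, k; split=> //; split; [apply: Qu|rewrite -e].
have Dt a g : List.In a t' -> D g -> D (a \o g).
  move=> ta [r [k [rs [Qk ->]]]].
  have [|k' [uk [_ [r' [rs' /= e]]]]] := u1 (a, r).
    by apply/List.in_prod_iff; split; right.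
  exists r', (k' \o k); split=> //; split; first by apply: gen_mul => //; apply: Qu.
  by rewrite compA e.
have DR g : gen (fun g => List.In g t) g -> R g /\ forall x, (D x -> D (g \o x)) /\ (D x -> D (inv g \o x)).
  elim=> {g} [|g tg|g h _ [Rg IHg] _ [Rh IHh]|g h _ [Rg IHg] /inv_eq <-].
  - by rewrite inv_id; split=> //; apply: subgroup_id.
  - split=> [|x]; first exact: t1.
    split=> Dx; apply: Dt => //; rewrite /t' List.in_app_iff; first by left.
    by right; apply: List.in_map.
  - split=> [|x]; first exact: subgroupM.
    split=> Dx; first by apply (IHg (h \o x)).1; apply (IHh x).1.
    by rewrite (invM (iR _ Rg) (iR _ Rh)); apply (IHh (inv g \o x)).2; apply (IHg x).2.
  - split=> [|x]; first exact: subgroupV.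
    by rewrite (invI (iR _ Rg)); have [] := IHg x.
move=> g Kg; have /t2/DR [_ /(_ id) [/(_ Did) + _]] := sKR _ Kg.
move=> [r [k [rs [Qk e]]]]; have {}e : g = r \o k := e.
have Kk : K k.
  by apply: (gen_min hK _ Qk) => a; rewrite List.in_app_iff => -[/uK|/vK].
have Kr : K r.
  have -> : r = g \o inv k.
    by rewrite e; apply: funext => x /=; rewrite (invK2 (subgroup_invertible hK Kk)).
  by apply: subgroupM => //; apply: subgroupV.
have [r' [vr' [_ er']]] := v1 _ rs.
by rewrite e; apply: gen_mul Qk; apply: Qv; rewrite -(er' Kr).
Qed.

End GroupTheory.

(** * Rooted trees and rays *)

Section RootedTrees.
Variable T : set (seq nat).
Hypothesis rootT : is_rooted_tree T.

Lemma tree_take n v : T v -> T (take n v).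
Proof.
elim/last_ind: v => [|v i IH] // Tvi.
have [lt|ge] := leqP (size (rcons v i)) n; first by rewrite take_oversize.
rewrite size_rcons ltnS in ge; rewrite -cats1 takel_cat //; apply: IH.
exact: rootT.2 Tvi.
Qed.

Lemma tree_prefix v w : T w -> prefix v w -> T v.
Proof. by move=> Tw; rewrite prefixE => /eqP <-; apply: tree_take. Qed.

Lemma prefix_child (v w : seq nat) : prefix v w -> w <> v ->
  prefix (rcons v (nth 0%N w (size v))) w.
Proof.
move=> /prefixP [[|i u] ->]; first by rewrite cats0.
by rewrite nth_cat ltnn subnn /= -cat_rcons prefix_prefix.
Qed.

Hypothesis lfT : locally_finite T.

Lemma level_finite n : exists s : seq (seq nat), forall v, T v -> size v = n -> v \in s.
Proof.
elim: n => [|n [s hs]]; first by exists [:: [::]] => -[].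
have [b hb] : exists b, forall v i, v \in s -> T v -> T (rcons v i) -> (i < b)%N.
  elim: s {hs} => [|v s [b hb]]; first by exists 0%N.
  have [Tv|nTv] := pselect (T v); last first.
    exists b => w i; rewrite inE => /orP [/eqP ->//|]; exact: hb.
  have [c hc] := lfT Tv; exists (maxn b c) => w i; rewrite inE => /orP [/eqP -> _ /hc|ws Tw Twi].
    by move=> lt; rewrite leq_max lt orbT.
  by rewrite leq_max (hb w).
exists [seq rcons v i | v <- s, i <- iota 0 b] => v.
case/lastP: v => // v i Tvi; rewrite size_rcons => -[sv].
have Tv := rootT.2 _ _ Tvi; have vs := hs _ Tv sv.
by apply/allpairsP; exists (v, i); rewrite mem_iota add0n /=; split=> //; apply: hb Tvi.
Qed.

Lemma konig : infinite_tree T -> exists xi, is_ray T xi.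
Proof.
move=> infT.
(* The vertices with infinitely many descendants: the root is one, and each has a child of the same
   kind, since otherwise the finite lists for its children would combine into one for it. *)
pose big v := T v /\ forall s : seq (seq nat), exists w, [/\ T w, prefix v w & w \notin s].
have big0 : big [::].
  split=> [|s]; first exact: rootT.1.
  apply: contrapT => n; apply: infT; exists s => v Tv.
  by apply/negPn/negP => vs; apply: n; exists v; rewrite prefix0s.
have bigS v : big v -> exists i, big (rcons v i).
  move=> [Tv bv]; apply: contrapT => n; have [b hb] := lfT Tv.
  have small i : (i < b)%N -> exists s : seq (seq nat), forall w, T w -> prefix (rcons v i) w -> w \in s.
    move=> ib; have [Tvi|nTvi] := pselect (T (rcons v i)).
      apply: contrapT => n'; apply: n; exists i; split=> // s.
      apply: contrapT => n2; apply: n'; exists s => w Tw pw.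
      by apply/negPn/negP => ws; apply: n2; exists w.
    by exists [::] => w Tw /(tree_prefix Tw).
  have [s hs] : exists s : seq (seq nat), forall i, (i < b)%N -> forall w, T w -> prefix (rcons v i) w -> w \in s.
    elim: b {hb} small => [|b IH] small; first by exists [::].
    have [|s hs] := IH; first by move=> i ib; apply: small; apply: ltnW.
    have [t ht] := small b (ltnSn b).
    exists (s ++ t) => i; rewrite ltnS leq_eqVlt => /orP [/eqP ->|ib] w Tw pw; rewrite mem_cat.
      by rewrite ht ?orbT.
    by rewrite (hs i).
  have [w [Tw pw]] := bv (v :: s); rewrite inE negb_or => /andP [/eqP wv /negP]; apply.
  have pc := prefix_child pw wv; apply: hs (pc) => //; apply: hb.
  exact: tree_prefix pc.
pose next v := xget 0%N [set i | big (rcons v i)].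
pose path n := iter n (fun v => rcons v (next v)) [::].
have pathP n : big (path n).
  by elim: n => [|n IH] //=; have := xgetPex 0%N (bigS _ IH).
exists (fun n => next (path n)) => n.
suff -> : mkseq (fun n => next (path n)) n = path n by have [] := pathP n.
by elim: n => [|n IH] //; rewrite mkseqS IH.
Qed.

End RootedTrees.

(** * Initial segments of sequences and separation of rays *)

Lemma take_mkseq (T : Type) (f : nat -> T) m n : (m <= n)%N -> take m (mkseq f n) = mkseq f m.
Proof. by move=> mn; rewrite /mkseq -map_take take_iota (minn_idPl mn). Qed.

Lemma prefix_mkseq (T : eqType) (f : nat -> T) m n : (m <= n)%N -> prefix (mkseq f m) (mkseq f n).
Proof. by move=> mn; rewrite prefixE size_mkseq take_mkseq. Qed.

Lemma eq_from_mkseq (T : Type) (f g : nat -> T) : (forall n, mkseq f n = mkseq g n) -> f = g.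
Proof.
move=> e; apply: funext => n.
by have := congr1 (fun s => nth (f n) s n) (e n.+1); rewrite !nth_mkseq.
Qed.

Lemma mkseq_neq (T : Type) (f g : nat -> T) m n : (m <= n)%N ->
  mkseq f m <> mkseq g m -> mkseq f n <> mkseq g n.
Proof. by move=> mn ne e; apply: ne; rewrite -!(take_mkseq _ mn) e. Qed.

Lemma neq_mkseq (T : Type) (f g : nat -> T) : f <> g -> exists n, mkseq f n <> mkseq g n.
Proof.
move=> ne; apply: contrapT => h; apply: ne; apply: eq_from_mkseq => n.
by apply: contrapT => h'; apply: h; exists n.
Qed.

Lemma separate_ray (T : choiceType) (l : seq (nat -> T)) xi : exists n, forall eta, eta \in l ->
  mkseq eta n = mkseq xi n -> eta = xi.
Proof.
elim: l => [|a l [n hn]]; first by exists 0%N.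
have [->|/neq_mkseq [m hm]] := pselect (a = xi).
  by exists n => eta; rewrite inE => /orP [/eqP ->//|]; apply: hn.
exists (maxn m n) => eta; rewrite inE => /orP [/eqP -> e|el e].
  by case: (mkseq_neq (leq_maxl m n) hm).
by apply: hn => //; rewrite -!(take_mkseq _ (leq_maxr m n)) e.
Qed.

Lemma separate_rays (T : choiceType) k (eta : 'I_k -> nat -> T) m : injective eta ->
  exists2 n, (m <= n)%N & forall i j, i != j -> mkseq (eta i) n <> mkseq (eta j) n.
Proof.
move=> inj_eta.
pose l := [seq eta i | i <- enum 'I_k].
have [f hf] := choice (fun i => separate_ray l (eta i)).
exists (maxn m (\max_i f i)); rewrite ?leq_maxl // => i j ij e.
move/negP: ij; apply; apply/eqP; apply: inj_eta; apply: (hf j).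
  by apply: map_f; rewrite mem_enum.
have le : (f j <= maxn m (\max_i f i))%N by rewrite leq_max leq_bigmax orbT.
by rewrite -!(take_mkseq _ le) e.
Qed.

(** This dichotomy serves as a cardinality count: at most [d] points are present as soon as the
    first case is excluded for [k = d.+1]. *)
Lemma family_or_cover (T : choiceType) (A : set T) k :
  (exists2 f : 'I_k -> T, injective f & forall i, A (f i)) \/
  (exists2 l : seq T, (size l < k)%N & forall x, A x <-> x \in l).
Proof.
elim: k => [|k [[f inj_f Af]|[l sl hl]]].
- left; have f : 'I_0 -> T by case.
  by exists f => [[]|[]].
- have [[a Aa na]|n] := pselect (exists2 a, A a & a \notin [seq f i | i <- enum 'I_k]).
    left; exists (fun i => if unlift ord_max i is Some j then f j else a) => [i j|i].
      case: unliftP => [i' ->|->]; case: unliftP => [j' ->|->] //.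
      + by move/inj_f ->.
      + by move=> e; case/negP: na; rewrite -e map_f ?mem_enum.
      + by move=> e; case/negP: na; rewrite e map_f ?mem_enum.
    by case: unliftP.
  right; exists [seq f i | i <- enum 'I_k]; first by rewrite size_map size_enum_ord.
  move=> x; split=> [Ax|/mapP [i _ ->]//].
  by apply/negPn/negP => nx; apply: n; exists x.
- by right; exists l => //; apply: ltnW.
Qed.

(** * Schreier graphs and products of commuting families *)

Section SchreierPaths.
Variable U : choiceType.
Implicit Types (P R : set (U -> U)) (g h : U -> U) (A : seq (U -> U)).

(** Words are lists of indices, hence vertices of a tree to which [konig] applies. The last letter
    acts last, so passing to a child is left multiplication, as along an edge of the Schreier
    graph. *)
Definition word_val A (w : seq nat) : U -> U := foldl (fun acc i => nth id A i \o acc) id w.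

Lemma word_val_rcons A w i : word_val A (rcons w i) = nth id A i \o word_val A w.
Proof. by rewrite /word_val -cats1 foldl_cat. Qed.

Lemma word_val_cat A w1 w2 : word_val A (w1 ++ w2) = word_val A w2 \o word_val A w1.
Proof.
elim/last_ind: w2 => [|w2 i IH]; first by rewrite cats0.
by rewrite -rcons_cat !word_val_rcons IH.
Qed.

Definition letters A (w : seq nat) := all (fun i => i < size A)%N w.

Lemma word_val_letter A g : List.In g A -> exists2 i, (i < size A)%N & nth id A i = g.
Proof. by move/InP => Ag; exists (index g A); rewrite ?index_mem ?nth_index. Qed.

(** The inverse is carried along for the sake of the constructor [gen_inv] in the induction. *)
Lemma gen_word s g : is_subgroup (gen (fun g => List.In g s)) -> gen (fun g => List.In g s) g ->
  let A := s ++ map (@inv U) s in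
  (exists2 w, letters A w & word_val A w = g) /\ (exists2 w, letters A w & word_val A w = inv g).
Proof.
move=> hs gs A; have inv_s a : gen (fun g => List.In g s) a -> invertible a.
  by apply: subgroup_invertible.
have lett a : List.In a A -> exists2 w, letters A w & word_val A w = a.
  by move/word_val_letter => [i lt e]; exists [:: i]; rewrite /letters /= ?lt // /word_val /= e.
elim: gs => {g} [|g sg|g h gg [[w1 l1 e1] [w2 l2 e2]] gh [[w3 l3 e3] [w4 l4 e4]]|g h gg [h1 h2] /inv_eq <-].
- by rewrite inv_id; split; exists [::].
- split; apply: lett; apply/List.in_app_iff; first by left.
  by right; apply: List.in_map.
- split; first by exists (w3 ++ w1); rewrite ?word_val_cat ?e1 ?e3 // /letters all_cat; apply/andP.
  exists (w2 ++ w4); first by rewrite /letters all_cat; apply/andP.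
  by rewrite word_val_cat e2 e4 (invM (inv_s _ gg) (inv_s _ gh)).
- by split=> //; rewrite (invI (inv_s _ gg)).
Qed.

(* A geodesic ray in the Schreier graph of R on R/P, from Koenig's lemma applied to the tree of
   geodesic words. *)
Lemma schreier_ray P R (s : seq (U -> U)) : is_subgroup P -> is_subgroup R -> P `<=` R ->
  generates R s -> ~ finite_index P R ->
  exists r : nat -> U -> U, [/\ forall n, R (r n),
    forall n, exists2 a, List.In a (s ++ map (@inv U) s) & r n.+1 = a \o r n &
    forall m n, (m < n)%N -> ~ P (inv (r m) \o r n)].
Proof.
move=> hP hR sPR [sR Rs] nfi; set A := s ++ map (@inv U) s.
have iR g : R g -> invertible g by apply: subgroup_invertible.
have genR : gen (fun g => List.In g s) = R.
  by apply/seteqP; split=> [|g /Rs//]; apply: gen_min.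
have AR a : List.In a A -> R a.
  rewrite List.in_app_iff => -[/sR//|/List.in_map_iff [b [<- /sR]]]; exact: subgroupV.
have nthR i : R (nth id A i).
  have [lt|ge] := ltnP i (size A); first by apply/AR/InP; rewrite mem_nth.
  by rewrite nth_default //; apply: subgroup_id.
have wR w : R (word_val A w).
  elim/last_ind: w => [|w i IH]; first exact: subgroup_id.
  by rewrite word_val_rcons; apply: subgroupM.
have iw w := iR _ (wR w).
(* The words of minimal length among those reaching their coset of [P]; a prefix of such a word is
   again minimal. *)
pose T w := letters A w /\ forall w', letters A w' ->
  P (inv (word_val A w') \o word_val A w) -> (size w <= size w')%N.
have rootT : is_rooted_tree T.
  split=> [|w i [lw hw]]; first by split.
  move: lw; rewrite /letters all_rcons => /andP [li lw]; split=> // w' lw' Pw.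
  have := hw (rcons w' i); rewrite !size_rcons ltnS; apply; first by rewrite /letters all_rcons li.
  rewrite !word_val_rcons (invM (iR _ (nthR i)) (iw _)).
  have -> // : inv (word_val A w') \o inv (nth id A i) \o (nth id A i \o word_val A w) =
    inv (word_val A w') \o word_val A w.
  by apply: funext => x /=; rewrite (invK1 (iR _ (nthR i))).
have lfT : locally_finite T.
  move=> w _; exists (size A) => i [+ _].
  by rewrite /letters all_rcons => /andP [].
(* A shortest word reaching the coset of [g] is geodesic, so a finite list of geodesic words would
   yield finitely many representatives for [R] modulo [P]. *)
have infT : infinite_tree T.
  move=> [t ht]; apply: nfi; exists (map (word_val A) t); split.
    by move=> r /List.in_map_iff [w [<- _]].
  move=> g Rg; pose q n := `[< exists w, [/\ letters A w, size w = n & P (inv (word_val A w) \o g)] >].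
  have ex_q : exists n, q n.
    have hg : is_subgroup (gen (fun g => List.In g s)) by rewrite genR.
    have [|[w lw e] _] := gen_word hg (_ : gen (fun g => List.In g s) g); first exact: Rs.
    exists (size w); apply/asboolP; exists w; split=> //.
    rewrite -e -/A; suff -> : inv (word_val A w) \o word_val A w = id by apply: subgroup_id.
    by apply: funext => x /=; rewrite (invK1 (iw _)).
  case: (ex_minnP ex_q) => n /asboolP [w [lw sw Pw]] minw.
  exists (word_val A w), (inv (word_val A w) \o g); split; last split=> //.
    apply: List.in_map; apply/InP/ht; split=> // w' lw' Pw'.
    rewrite sw; apply: minw; apply/asboolP; exists w'; split=> //.
    have -> : inv (word_val A w') \o g =
      (inv (word_val A w') \o word_val A w) \o (inv (word_val A w) \o g).
      by apply: funext => x /=; rewrite (invK2 (iw _)).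
    exact: subgroupM.
  by apply: funext => x /=; rewrite (invK2 (iw _)).
have [xi xiT] := konig rootT lfT infT.
exists (fun n => word_val A (mkseq xi n)); split=> [n|n|m n mn Pmn].
- exact: wR.
- exists (nth id A (xi n)); last by rewrite mkseqS word_val_rcons.
  have [+ _] := xiT n.+1; rewrite mkseqS /letters all_rcons => /andP [lt _].
  by apply/InP; rewrite mem_nth.
- have [lm _] := xiT m; have [_ /(_ _ lm Pmn)] := xiT n.
  by rewrite !size_mkseq leqNgt mn.
Qed.

(** * Products of families whose members with different indices commute *)

Definition commute g h := g \o h = h \o g.

Lemma commute_comp g h k : commute g h -> commute g k -> commute g (h \o k).
Proof.
move=> gh gk; apply: funext => x.
rewrite -[LHS]/((g \o h) (k x)) gh /= -[in LHS]/((g \o k) x) gk //.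
Qed.

Lemma commute_sym g h : commute g h -> commute h g.
Proof. by move/esym. Qed.

Lemma commuteV g h : invertible h -> commute g h -> commute g (inv h).
Proof.
move=> ih gh; apply: funext => x; apply: (can_inj (invK1 ih)) => /=.
have e y : h (g y) = g (h y) by rewrite -[LHS]/((h \o g) y) -gh.
by rewrite e !(invK2 ih).
Qed.

Section Products.
Variable I : eqType.
Implicit Types (F E : I -> U -> U) (l : seq I).

Definition prodf F l : U -> U := foldr (fun i acc => F i \o acc) id l.

Lemma prodf_ind (K : set (U -> U)) F l : K id -> (forall g h, K g -> K h -> K (g \o h)) ->
  (forall i, i \in l -> K (F i)) -> K (prodf F l).
Proof.
move=> K1 KM; elim: l => [|i l IH] // h; apply: KM; first by apply: h; rewrite mem_head.
by apply: IH => j jl; apply: h; rewrite inE jl orbT.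
Qed.

Lemma eq_prodf F E l : (forall i, i \in l -> F i = E i) -> prodf F l = prodf E l.
Proof.
elim: l => [|i l IH] //= h; rewrite h ?mem_head // IH // => j jl.
by apply: h; rewrite inE jl orbT.
Qed.

Lemma commute_prodf g F l : (forall i, i \in l -> commute g (F i)) -> commute g (prodf F l).
Proof. by move=> h; apply: prodf_ind => // a b; apply: commute_comp. Qed.

(** Only factors with different indices are moved past each other, so [F i] and [E i] may fail to
    commute. *)
Lemma prodfM F E l : uniq l ->
  (forall i j, i \in l -> j \in l -> i != j -> commute (F i) (E j)) ->
  prodf (fun i => F i \o E i) l = prodf F l \o prodf E l.
Proof.
elim: l => [|i l IH] //= /andP [il ul] h; rewrite IH //; last first.
  by move=> a b al bl; apply: h; rewrite inE ?al ?bl orbT.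
have c : commute (E i) (prodf F l).
  apply: commute_prodf => j jl; apply: commute_sym; apply: h; rewrite ?inE ?jl ?eqxx ?orbT //.
  by apply: contraNneq il => <-.
apply: funext => x; exact: (congr1 (fun k => F i (k (prodf E l x))) c).
Qed.

Lemma prodf_only i g l : uniq l -> i \in l -> prodf (fun j => if j == i then g else id) l = g.
Proof.
elim: l => [|j l IH] //= /andP [jl ul]; rewrite inE; have [e _|ne /= il] := eqVneq i j.
  subst j; rewrite (@eq_prodf _ (fun _ => id)).
    by rewrite /prodf; elim: l {IH ul jl} => //= j l IH; rewrite -[RHS]IH.
  by move=> j jl'; case: eqP => // e; rewrite -e jl' in jl.
exact: IH.
Qed.

Lemma prodf_split F l i : uniq l -> i \in l ->
  (forall i j, i \in l -> j \in l -> i != j -> commute (F i) (F j)) ->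
  prodf F l = F i \o prodf (fun j => if j == i then id else F j) l.
Proof.
move=> ul il h.
rewrite -[F i in RHS](@prodf_only i (F i) l) // -prodfM //.
  by apply: eq_prodf => j _; case: eqP => [->|].
move=> a b al bl ab; case: (eqVneq a i) => [ai|_]; last by [].
by case: (eqVneq b i) => // bi; rewrite -ai; apply: h.
Qed.

End Products.
End SchreierPaths.

(** * Lower bounds for leud *)

Section WordLength.
Variables (X : topologicalType) (H : set (X -> X)) (S : seq (X -> X)).
Hypotheses (hH : is_subgroup H) (genS : fin_sym_gen H S).
Implicit Types (g h : X -> X).

Definition word_le (n : nat) h :=
  exists w : seq (X -> X), [/\ forall s, List.In s w -> List.In s S, (size w <= n)%N &
    h = apply_word w id].

Lemma apply_word_comp (w : seq (X -> X)) g h : apply_word w (g \o h) = apply_word w g \o h.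
Proof. by rewrite /apply_word; elim: w g => //= s w IH g; rewrite -IH. Qed.

Lemma word_le_id n : word_le n id.
Proof. by exists [::]. Qed.

Lemma word_leM m n g h : word_le m g -> word_le n h -> word_le (m + n) (g \o h).
Proof.
move=> [v [vS sv ->]] [w [wS sw ->]]; exists (w ++ v); split.
- by move=> s /List.in_app_iff [/wS|/vS].
- by rewrite size_cat addnC leq_add.
- rewrite /apply_word foldl_cat; exact: esym (apply_word_comp v id (apply_word w id)).
Qed.

Lemma word_le_trans m n h : (m <= n)%N -> word_le m h -> word_le n h.
Proof. by move=> mn [w [wS sw ->]]; exists w; split=> //; apply: leq_trans mn. Qed.

Lemma word_le_ex h : H h -> exists n, word_le n h.
Proof.
have [[SH HS] symS] := genS => /HS.
have iH g : gen (fun s => List.In s S) g -> invertible g.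
  by move=> /(gen_min hH SH); apply: subgroup_invertible.
move=> gh; suff [] : (exists n, word_le n h) /\ (exists n, word_le n (inv h)) by [].
have le1 s : List.In s S -> word_le 1 s by move=> Ss; exists [:: s]; split=> // t [<-|[]].
elim: gh => {h} [|s Ss|g h gg [[a wa] [a' wa']] gh [[b wb] [b' wb']]|g h gg [h1 h2] /inv_eq <-].
- by rewrite inv_id; split; exists 0%N; apply: word_le_id.
- have [t [St /inv_eq ->]] := symS _ Ss.
  by split; exists 1%N; apply: le1.
- split; first by exists (a + b)%N; apply: word_leM.
  by exists (b' + a')%N; rewrite (invM (iH _ gg) (iH _ gh)); apply: word_leM.
- by split=> //; rewrite (invI (iH _ gg)).
Qed.

Lemma word_le_seq (l : seq (X -> X)) : (forall h, List.In h l -> H h) ->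
  exists n, forall h, List.In h l -> word_le n h.
Proof.
elim: l => [|g l IH] hl; first by exists 0%N.
have [n hn] := IH (fun h lh => hl h (or_intror lh)).
have [m hm] := word_le_ex (hl g (or_introl erefl)).
exists (maxn m n) => h [<-|/hn lh]; [apply: word_le_trans hm|apply: word_le_trans lh].
  exact: leq_maxl.
exact: leq_maxr.
Qed.

(** Edges of the graph of germs are left multiplications by [S], so a word for the left factor [u]
    is a path from the coset of [g] to that of [u \o g]. *)
Lemma germ_dist_word x g u n : H (u \o g) -> word_le n u -> germ_dist_le H S x g (u \o g) n.
Proof.
move=> Hug [w [wS sw uw]]; exists w; do 2!split=> //.
have iug := subgroup_invertible hH Hug.
exists (inv (u \o g)); split; first exact: subgroupV.
split=> //; have -> : apply_word w g = u \o g.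
  by rewrite uw; exact: (apply_word_comp w id g).
have [-> _] := iug; split; first exact: subgroup_id.
exact: nearW.
Qed.

End WordLength.

(** * Maps from the grid to the graph of germs built from commuting subgroups *)

Section LeudLowerBound.
Variables (U : choiceType) (G : set (U -> U)).
Variables (X : topologicalType) (H : set (X -> X)) (S : seq (X -> X)).
Variable rho : (U -> U) -> (X -> X).
Hypotheses (hG : is_subgroup G) (hH : is_subgroup H) (genS : fin_sym_gen H S).
Hypothesis rhoH : forall g, G g -> H (rho g).
Hypothesis rhoM : forall g h, G g -> G h -> rho (g \o h) = rho g \o rho h.

Lemma rho_inv_pair g : G g -> invertible (rho g).
Proof. by move/rhoH; apply: subgroup_invertible. Qed.

Lemma rho_id : rho id = id.
Proof.
have G1 := subgroup_id hG; have i1 := rho_inv_pair G1.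
have e : rho id = rho id \o rho id by rewrite -rhoM.
apply: funext => x; apply: (can_inj (invK1 i1)).
exact: esym (congr1 (fun f => f x) e).
Qed.

Lemma rhoV g : G g -> rho (inv g) = inv (rho g).
Proof.
move=> Gg; have Gi := subgroupV hG Gg; symmetry; apply: inv_eq.
have [e1 e2] := subgroup_invertible hG Gg.
by split; rewrite -rhoM // ?e1 ?e2 rho_id.
Qed.

Variables (x : X) (k : nat) (R P : 'I_k -> set (U -> U)).
Hypotheses (hR : forall i, is_subgroup (R i)) (RG : forall i, R i `<=` G).
Hypothesis fgR : forall i, finitely_generated (R i).
Hypothesis commR : forall i j g h, i != j -> R i g -> R j h -> commute g h.
Hypotheses (hP : forall i, is_subgroup (P i)) (PR : forall i, P i `<=` R i).
Hypothesis infP : forall i, ~ finite_index (P i) (R i).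
Hypothesis germP : forall b : 'I_k -> U -> U, (forall i, R i (b i)) ->
  H0 H x (rho (prodf b (index_enum 'I_k))) -> forall i, P i (b i).

Lemma prodf_G (b : 'I_k -> U -> U) l : (forall i, R i (b i)) -> G (prodf b l).
Proof.
move=> Rb; apply: prodf_ind => [|g h|i _]; first exact: subgroup_id.
- exact: subgroupM.
- exact: RG (Rb i).
Qed.

(** A point [p] of the grid is sent to the product of the [r i (tnth p i)], with [r i] a geodesic
    ray in the Schreier graph of [R i] modulo [P i]. Changing the coordinates is left multiplication
    by a product of short elements, by commutation; [germP] recovers each coordinate from the
    germ. *)
Lemma leud_lower_bound : leud_admits H S x k.
Proof.
have [s hs] := choice fgR.
have rays i := schreier_ray (hP i) (hR i) (@PR i) (hs i) (@infP i).
have [r hr] := choice rays.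
have rR i n : R i (r i n) by have [] := hr i.
have [L hL] : exists L, forall i a, List.In a (s i ++ map (@inv U) (s i)) ->
    word_le S L (rho a) /\ word_le S L (rho (inv a)).
  have bound i : exists n, forall a, List.In a (s i ++ map (@inv U) (s i)) ->
      word_le S n (rho a) /\ word_le S n (rho (inv a)).
    set A := _ ++ _.
    have AG a : List.In a A -> G a.
      have [sR _] := hs i; rewrite /A List.in_app_iff => -[/sR/RG//|/List.in_map_iff [b [<- /sR/RG]]].
      exact: subgroupV.
    have [|n hn] := word_le_seq hH genS (l := map rho (A ++ map (@inv U) A)).
      move=> h /List.in_map_iff [a [<- /List.in_app_iff [/AG/rhoH//|/List.in_map_iff [b [<- /AG]]]]].
      by move=> Gb; apply: rhoH; apply: subgroupV.
    exists n => a Aa; split; apply: hn; apply: List.in_map; apply/List.in_app_iff.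
      by left.
    by right; apply: List.in_map.
  have [L hL] := choice bound; exists (\max_i L i) => i a /hL [h1 h2].
  by split; [apply: word_le_trans h1|apply: word_le_trans h2]; apply: leq_bigmax.
(* The bound on the inverse of [u] serves to move down the ray in [move_to]. *)
have up i m n : exists u, [/\ R i u, r i (m + n)%N = u \o r i m,
    word_le S (L * n) (rho u) & word_le S (L * n) (rho (inv u))].
  elim: n => [|n [u [Ru e w1 w2]]].
    exists id; rewrite addn0 inv_id rho_id; split=> //; first exact: subgroup_id.
      exact: word_le_id.
    exact: word_le_id.
  have [_ rS _] := hr i; have [a Aa ea] := rS (m + n)%N.
  have [sR _] := hs i; have Ra : R i a.
    move: Aa; rewrite List.in_app_iff => -[/sR//|/List.in_map_iff [b [<- /sR]]].
    exact: subgroupV.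
  have [v1 v2] := hL _ _ Aa; have Ga := RG Ra; have Gu := RG Ru.
  exists (a \o u); split.
  - exact: subgroupM.
  - by rewrite addnS ea e.
  - by rewrite rhoM // mulnS; apply: word_leM.
  - rewrite (invM (subgroup_invertible hG Ga) (subgroup_invertible hG Gu)).
    rewrite rhoM ?mulnS 1?addnC; [exact: word_leM|exact: subgroupV|exact: subgroupV].
have move_to i m n : exists u, [/\ R i u, r i n = u \o r i m &
    word_le S (L * ((m - n) + (n - m))) (rho u)].
  have [mn|/ltnW nm] := leqP m n.
    have [u [Ru e w1 _]] := up i m (n - m)%N; rewrite subnKC // in e.
    exists u; split=> //; apply: word_le_trans w1.
    by rewrite leq_mul2l leq_addl orbT.
  have [u [Ru e _ w2]] := up i n (m - n)%N; rewrite subnKC // in e.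
  exists (inv u); split; first exact: subgroupV.
    by rewrite e; apply: funext => z /=; rewrite (invK1 (subgroup_invertible (hR i) Ru)).
  by apply: word_le_trans w2; rewrite leq_mul2l leq_addr orbT.
have prodM (a b : 'I_k -> U -> U) : (forall i, R i (a i)) -> (forall i, R i (b i)) ->
  prodf (fun i => a i \o b i) (index_enum 'I_k) =
  prodf a (index_enum 'I_k) \o prodf b (index_enum 'I_k).
  move=> Ra Rb; apply: prodfM => [|i j _ _ ij]; first exact: index_enum_uniq.
  exact: commR ij _ _.
pose F (p : k.-tuple nat) i := r i (tnth p i).
pose f p := rho (prodf (F p) (index_enum 'I_k)).
have FR p i : R i (F p i) by apply: rR.
exists f; split; first by move=> p; apply: rhoH; apply: prodf_G.
split.
  exists L => p q.
  have [u hu] := choice (fun i => move_to i (tnth p i) (tnth q i)).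
  have Ru i : R i (u i) by have [] := hu i.
  have -> : f q = rho (prodf u (index_enum 'I_k)) \o f p.
    rewrite /f -(rhoM (prodf_G _ Ru) (prodf_G _ (FR p))) -(prodM _ _ Ru (FR p)).
    by congr (rho _); apply: eq_prodf => i _; have [] := hu i.
  apply: germ_dist_word => //.
    by apply: subgroupM => //; apply: rhoH; apply: prodf_G.
  rewrite /l1dist; elim: (index_enum _) => [|i l IH].
    by rewrite big_nil /= rho_id; apply: word_le_id.
  rewrite big_cons /= (rhoM (RG (Ru i)) (prodf_G l Ru)).
  by rewrite mulnDr; apply: word_leM => //; have [] := hu i.
(* The map is injective on cosets, so fibres have at most one point. *)
exists 1%N => h Hh [|p [|q t]] // upq same.
have pq : p = q; last by move: upq; rewrite pq /= mem_head.
have [hi [_ [ih [_ hp]]]] := same p (mem_head _ _).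
have [|hi' [_ [ih' [_ hq]]]] := same q; first by rewrite !inE eqxx orbT.
rewrite -(is_inv_uniq ih ih') in hq.
(* By commutation [f q] is [f p] followed on the right by the product of the [b i]. If both lie in
   one coset, this product has trivial germ, so each [b i] lies in [P i], and two different
   positions on a geodesic ray exclude that. *)
pose b i := inv (F p i) \o F q i.
have Rb i : R i (b i) by apply: subgroupVl.
have fq : f q = f p \o rho (prodf b (index_enum 'I_k)).
  rewrite /f -(rhoM (prodf_G _ (FR p)) (prodf_G _ Rb)) -(prodM _ _ (FR p) Rb).
  congr (rho _); apply: eq_prodf => i _; apply: funext => z /=.
  by rewrite (invK2 (subgroup_invertible (hR i) (FR p i))).
have Hf : H (f p) by apply: rhoH; apply: prodf_G.
have := germP Rb; have hb : H0 H x (rho (prodf b (index_enum 'I_k))).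
  split; first by apply: rhoH; apply: prodf_G.
  near=> z.
  have : (hi \o f p) (rho (prodf b (index_enum 'I_k)) z) = (hi \o f p) z.
    have -> : (hi \o f p) z = z by near: z.
    rewrite -[LHS]/(hi ((f p \o rho (prodf b (index_enum 'I_k))) z)) -fq.
    by near: z.
  rewrite -(inv_eq ih) => /(can_inj (invK2 (subgroup_invertible hH Hh))) e.
  exact: (can_inj (invK1 (subgroup_invertible hH Hf)) e).
move=> /(_ hb) Pb; apply: eq_from_tnth => i; have Pi := Pb i.
have [_ _ dist] := hr i.
case: (ltngtP (tnth p i) (tnth q i)) => // lt; first by case: (dist _ _ lt).
case: (dist _ _ lt); have := subgroupV (hP i) Pi.
rewrite (invM (invertible_inv (subgroup_invertible (hR i) (FR p i))) (subgroup_invertible (hR i) (FR q i))).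
by rewrite (invI (subgroup_invertible (hR i) (FR p i))).
Unshelve. all: by end_near.
Qed.

End LeudLowerBound.

(** * Rigid stabilizers *)

Section BranchAction.
Variables (T : set (seq nat)) (G : set (seq nat -> seq nat)).
Hypotheses (rootT : is_rooted_tree T) (lfT : locally_finite T).
Hypotheses (hG : is_subgroup G) (autG : forall g, G g -> is_tree_aut T g).
Implicit Types (g h r a b : seq nat -> seq nat) (v w u z : seq nat).

Lemma aut_off g v : G g -> ~ T v -> g v = v.
Proof. by move/autG => [h _]; apply: h. Qed.

Lemma aut_in g v : G g -> T v -> T (g v).
Proof. by move/autG => [_ [h _]]; apply: h. Qed.

Lemma G_invertible g : G g -> invertible g.
Proof. exact: subgroup_invertible. Qed.

Lemma aut_inj g : G g -> injective g.
Proof. by move/G_invertible/invK1/can_inj. Qed.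

(** Adjacency alone would also allow the image of the child to be the parent of [g v]; by induction
    that parent is the image of the parent of [v], against injectivity. *)
Lemma aut_child g v i : G g -> T (rcons v i) -> exists j, g (rcons v i) = rcons (g v) j.
Proof.
move=> Gg; have [_ [_ [_ [g0 adjg]]]] := autG Gg.
have adjc v' i' : adj v' (rcons v' i') by left; exists i'.
elim/last_ind: v i => [|v a IH] i Tvi; have Tv := rootT.2 _ _ Tvi.
all: have [//|[j e]] := (adjg _ _ Tv Tvi).1 (adjc _ _).
  by move/(congr1 size): e; rewrite g0 size_rcons.
have [b eb] := IH a Tv.
move: e; rewrite eb => /rcons_inj [/(aut_inj Gg) /(congr1 size)].
rewrite !size_rcons => e; have := leqnn (size v).
by rewrite {1}e ltnNge leqnSn.
Qed.

Lemma aut_size g v : G g -> size (g v) = size v.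
Proof.
move=> Gg; have [Tv|/(aut_off Gg) -> //] := pselect (T v).
elim/last_ind: v Tv => [|v i IH] Tvi; first by have [_ [_ [_ [-> _]]]] := autG Gg.
have [j ->] := aut_child Gg Tvi.
by rewrite !size_rcons IH //; apply: rootT.2 Tvi.
Qed.

Lemma aut_take g n v : G g -> T v -> g (take n v) = take n (g v).
Proof.
move=> Gg; elim/last_ind: v => [|v i IH] Tvi.
  by have [_ [_ [_ [-> _]]]] := autG Gg.
have [lt|ge] := leqP (size (rcons v i)) n.
  by rewrite !take_oversize // (aut_size _ Gg).
have [j ->] := aut_child Gg Tvi; rewrite size_rcons ltnS in ge.
rewrite -!cats1 !takel_cat ?(aut_size _ Gg) // IH //; exact: rootT.2 Tvi.
Qed.

Lemma aut_prefix g v w : G g -> T w -> prefix v w -> prefix (g v) (g w).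
Proof. by move=> Gg Tw; rewrite !prefixE (aut_size v Gg) -(aut_take _ Gg Tw) => /eqP ->. Qed.

Lemma ray_actE g xi n : G g -> is_ray T xi -> mkseq (ray_act g xi) n = g (mkseq xi n).
Proof.
move=> Gg xiT; apply: (@eq_from_nth _ 0%N); rewrite size_mkseq ?(aut_size _ Gg) ?size_mkseq //.
move=> i lt; rewrite nth_mkseq // /ray_act.
by rewrite -(take_mkseq xi lt) (aut_take _ Gg (xiT n)) nth_take.
Qed.

Lemma is_ray_act g xi : G g -> is_ray T xi -> is_ray T (ray_act g xi).
Proof. by move=> Gg xiT n; rewrite ray_actE //; apply: aut_in. Qed.

Lemma ray_act_comp g h xi : G g -> G h -> is_ray T xi ->
  ray_act (g \o h) xi = ray_act g (ray_act h xi).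
Proof.
move=> Gg Gh xiT; apply: eq_from_mkseq => n; have Ggh := subgroupM hG Gg Gh.
by rewrite !ray_actE //; apply: is_ray_act.
Qed.

Lemma ray_act_id xi : ray_act id xi = xi.
Proof. by apply: funext => n; rewrite /ray_act nth_mkseq. Qed.

Lemma ray_actK g xi : G g -> is_ray T xi -> ray_act (inv g) (ray_act g xi) = xi.
Proof.
move=> Gg xiT; rewrite -ray_act_comp //; last exact: subgroupV.
by have [-> _] := G_invertible Gg; apply: ray_act_id.
Qed.

Lemma rist_G v : rist T G v `<=` G.
Proof. by move=> g []. Qed.

Lemma rist_fix v g w : rist T G v g -> ~~ prefix v w -> g w = w.
Proof.
move=> [Gg h] nvw; have [Tw|nTw] := pselect (T w); first exact: h.
exact: aut_off.
Qed.

Lemma eq_prefix_size v w u : prefix v u -> prefix w u -> size v = size w -> v = w.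
Proof. by rewrite !prefixE => /eqP ev /eqP ew e; rewrite -ev -ew e. Qed.

(** If [g] moved [v], then [g v], having the same length, would lie outside the subtree at [v] and
    be fixed by [g], against injectivity. *)
Lemma rist_base v g : rist T G v g -> g v = v.
Proof.
move=> rg; have Gg := rist_G rg; apply: contrapT => ne.
apply: (ne); apply: (aut_inj Gg); apply: (rist_fix rg); apply/negP => pv.
by apply: ne; symmetry; apply: eq_prefix_size pv (prefix_refl _) _; rewrite (aut_size _ Gg).
Qed.

Lemma rist_prefix v g w : rist T G v g -> prefix v w -> prefix v (g w).
Proof.
move=> rg pv; have Gg := rist_G rg.
have [Tw|nTw] := pselect (T w); last by rewrite (aut_off Gg nTw).
by rewrite -(rist_base rg); apply: aut_prefix.
Qed.

Lemma rist_subgroup v : is_subgroup (rist T G v).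
Proof.
apply: subgroupP => [|g h rg rh|g /rist_G/G_invertible //|g rg].
- by split=> //; apply: subgroup_id.
- split; first by apply: (subgroupM hG); [exact: rist_G rg|exact: rist_G rh].
  by move=> w _ nw /=; rewrite (rist_fix rh) // (rist_fix rg).
- have Gg := rist_G rg; split; first exact: subgroupV.
  by move=> w _ nw; rewrite -{1}(rist_fix rg nw) (invK1 (G_invertible Gg)).
Qed.

Lemma rist_mono v w : prefix v w -> rist T G w `<=` rist T G v.
Proof.
move=> pvw g rg; split; first exact: rist_G rg.
move=> z _ nz; apply: (rist_fix rg); apply: contra nz; exact: prefix_trans.
Qed.

Lemma rist_conj g v h : G g -> T v -> rist T G v h -> rist T G (g v) (g \o h \o inv g).
Proof.
move=> Gg Tv rh; have Gh := rist_G rh; have Gi := subgroupV hG Gg.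
split; first by do !apply: subgroupM.
move=> w Tw nw /=; rewrite (rist_fix rh) ?(invK2 (G_invertible Gg)) //.
apply: contra nw => /(aut_prefix Gg (aut_in Gi Tw)).
by rewrite (invK2 (G_invertible Gg)).
Qed.

Lemma rist_commute v w g h : size v = size w -> v <> w ->
  rist T G v g -> rist T G w h -> commute g h.
Proof.
move=> svw vw rg rh; apply: funext => z /=.
have disj u : prefix v u -> ~~ prefix w u.
  by move=> pv; apply/negP => pw; apply: vw; apply: eq_prefix_size pv pw svw.
have [pv|nv] := boolP (prefix v z).
  by rewrite !(rist_fix rh) //; apply: disj => //; apply: rist_prefix pv.
rewrite (rist_fix rg nv) (rist_fix rg) //.
have [pw|nw] := boolP (prefix w z); last by rewrite (rist_fix rh).
by apply/negP => /disj; rewrite (rist_prefix rh).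
Qed.

(* The component of g in Rist(v), for g in the rigid stabilizer of the level of v. *)
Definition res v g w := if prefix v w then g w else w.

Lemma res_rist v g : rist T G v g -> res v g = g.
Proof. by move=> rg; apply: funext => w; rewrite /res; case: ifPn => // /(rist_fix rg). Qed.

Lemma rist_level_sub n : rist_level T G n `<=` G.
Proof. by apply: gen_min => // g [v [_ [_ /rist_G]]]. Qed.

Lemma rist_level_subgroup n : is_subgroup (rist_level T G n).
Proof. by apply: gen_subgroup => g [v [_ [_ /rist_G /G_invertible]]]. Qed.

Lemma rist_level_short n g w : rist_level T G n g -> (size w < n)%N -> g w = w.
Proof.
move=> rg sw; elim: rg => {g} [|g [v [_ [sv rv]]]|g h _ IHg _ IHh|g h rg IH /inv_eq <-] //=.
- apply: (rist_fix rv); apply/negP => /prefixP [s e].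
  by move: sw; rewrite e size_cat sv ltnNge leq_addr.
- by rewrite IHh.
- by rewrite -{1}IH (invK1 (G_invertible (rist_level_sub rg))).
Qed.

Lemma res_comp v g h : (forall w, prefix v w -> prefix v (h w)) ->
  res v (g \o h) = res v g \o res v h.
Proof.
move=> hp; apply: funext => w; rewrite /res /=; case: (boolP (prefix v w)) => [pv|/negPf ->//].
by rewrite hp.
Qed.

(** The component of a generator at [v] is either the generator itself or trivial, and [res v] is
    multiplicative on elements preserving the subtree at [v]. In particular components stay inside
    [G]. *)
Lemma rist_level_res n v g : size v = n -> rist_level T G n g -> rist T G v (res v g).
Proof.
move=> sv; elim=> {g} [|g [u [_ [su ru]]]|g h _ rg _ rh|g h rg' rg gh].
- have -> : res v id = id by apply: funext => w; rewrite /res; case: ifP.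
  exact: subgroup_id (rist_subgroup v).
- have [e|ne] := pselect (u = v); first by rewrite -e res_rist.
  have -> : res v g = id; last exact: subgroup_id (rist_subgroup v).
  apply: funext => w; rewrite /res; case: ifP => // pv; apply: (rist_fix ru).
  by apply/negP => pu; apply: ne; apply: eq_prefix_size pu pv _; rewrite su.
- rewrite res_comp; first exact: subgroupM (rist_subgroup v) rg rh.
  by move=> w pv; have := rist_prefix rh pv; rewrite /res pv.
have ir := G_invertible (rist_G rg).
have rgi := subgroupV (rist_subgroup v) rg.
suff -> : res v h = inv (res v g) by [].
apply: funext => w; rewrite {1}/res; case: ifPn => pv; last by rewrite (rist_fix rgi).
have pi := rist_prefix rgi pv.
have {1}<- : g (inv (res v g) w) = w by rewrite -[RHS](invK2 ir) {2}/res pi.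
by rewrite -(inv_eq gh) (invK1 (G_invertible (rist_level_sub rg'))).
Qed.

Lemma rist_level_prefix n v g w : size v = n -> rist_level T G n g -> prefix v w -> prefix v (g w).
Proof. by move=> sv rg pv; have := rist_prefix (rist_level_res sv rg) pv; rewrite /res pv. Qed.

Lemma res_levelM v g h : rist_level T G (size v) h -> res v (g \o h) = res v g \o res v h.
Proof. by move=> rh; apply: res_comp => w; apply: rist_level_prefix rh. Qed.

Lemma res_id v : res v id = id.
Proof. by apply: funext => w; rewrite /res; case: ifP. Qed.

Lemma res_levelV v g : rist_level T G (size v) g -> res v (inv g) = inv (res v g).
Proof.
move=> rg; have rgi := subgroupV (rist_level_subgroup _) rg.
symmetry; apply: inv_eq; split; rewrite -res_levelM //.
  by have [-> _] := G_invertible (rist_level_sub rg); rewrite res_id.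
by have [_ ->] := G_invertible (rist_level_sub rg); rewrite res_id.
Qed.

Lemma res_comm v g h : rist_level T G (size v) g -> rist_level T G (size v) h ->
  res v (comm g h) = comm (res v g) (res v h).
Proof.
move=> rg rh; have hL := rist_level_subgroup (size v).
have rgi := subgroupV hL rg; have rhi := subgroupV hL rh.
rewrite /comm (@res_levelM v _ h) // (@res_levelM v _ g) // (@res_levelM v (inv g)) //.
by rewrite (res_levelV rg) (res_levelV rh).
Qed.

Lemma prodf_res n g (vs : seq (seq nat)) w : rist_level T G n g -> uniq vs ->
  (forall v, v \in vs -> size v = n) ->
  prodf (fun v => res v g) vs w = if has (fun v => prefix v w) vs then g w else w.
Proof.
move=> rg; elim: vs => [|v vs IH] //= /andP [nv uvs] svs.
rewrite IH //; last by move=> u uv; apply: svs; rewrite inE uv orbT.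
have [/hasP [u uv pu]|_] := boolP (has (fun v => prefix v w) vs); last by rewrite orbF.
rewrite orbT /res ifN //; apply/negP => pv.
have su : size u = n by apply: svs; rewrite inE uv orbT.
have := eq_prefix_size pv (rist_level_prefix su rg pu).
by rewrite su svs ?mem_head // => /(_ erefl) e; rewrite e uv in nv.
Qed.

(** Each tree vertex either lies below exactly one vertex of level [n] or is shorter and therefore
    fixed; words off the tree are fixed as well. *)
Lemma rist_level_prodf n : exists vs : seq (seq nat), (forall v, v \in vs -> T v /\ size v = n) /\
  forall g, rist_level T G n g -> g = prodf (fun v => res v g) vs.
Proof.
have [s hs] := level_finite rootT lfT n.
exists (undup [seq v <- s | `[< T v >] && (size v == n)]).
have mem v : v \in undup [seq v <- s | `[< T v >] && (size v == n)] -> T v /\ size v = n.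
  by rewrite mem_undup mem_filter => /andP [/andP [/asboolP Tv /eqP sv] _].
split=> // g rg; apply: funext => w; rewrite (prodf_res _ rg) ?undup_uniq //; last first.
  by move=> v /mem [].
case: ifPn => // /hasPn no.
have [Tw|nTw] := pselect (T w); last by rewrite (aut_off (rist_level_sub rg)).
have [sw|sw] := ltnP (size w) n; first exact: rist_level_short rg _.
have Tt := tree_take rootT n Tw.
have st : size (take n w) = n by rewrite size_takel.
have := no (take n w); rewrite mem_undup mem_filter hs // asboolT //= st eqxx prefix_take.
by move=> /(_ isT).
Qed.

(** The component of a commutator is the commutator of the components, so a commutator in the
    product is a product of commutators from the factors. *)
Lemma derived_rist_level n (K : set (seq nat -> seq nat)) : is_subgroup K ->
  (forall v, T v -> size v = n -> derived (rist T G v) `<=` K) ->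
  derived (rist_level T G n) `<=` K.
Proof.
move=> hK hv; have hL := rist_level_subgroup n.
apply: derived_sub_of => // g h rg rh; have rc := comm_subgroup hL rg rh.
have [vs [vsT dec]] := rist_level_prodf n; rewrite (dec _ rc).
apply: prodf_ind => [|a b|v /vsT [Tv sv]]; first exact: subgroup_id.
  exact: subgroupM.
apply: (hv v) => //; rewrite res_comm ?sv //.
by apply: derived_comm; [exact: rist_subgroup|apply: rist_level_res sv _|apply: rist_level_res sv _].
Qed.

(** The rigid level stabilizer is finitely generated by Schreier's lemma, and [res v] maps it onto
    Rist(v). *)
Lemma rist_finitely_generated v : T v -> finite_index (rist_level T G (size v)) G ->
  finitely_generated G -> finitely_generated (rist T G v).
Proof.
move=> Tv fi fgG; have hL := rist_level_subgroup (size v).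
have [s [sL Ls]] := finitely_generated_finite_index hL hG (@rist_level_sub _) fi fgG.
have iL g : gen (fun g => List.In g s) g -> rist_level T G (size v) g by apply: gen_min.
exists (map (res v) s); split.
  by move=> g /List.in_map_iff [a [<- /sL]]; apply: rist_level_res.
move=> g rg; rewrite -(res_rist rg).
have : rist_level T G (size v) g by apply: gen_base; exists v.
move/Ls; elim=> {g rg} [|g sg|g h gg IHg gh IHh|g h gg IHg /inv_eq <-].
- by rewrite res_id; apply: gen_id.
- by apply: gen_base; apply: List.in_map.
- by rewrite (res_levelM _ (iL _ gh)); apply: gen_mul.
- rewrite (res_levelV (iL _ gg)); apply: (gen_inv IHg).
  exact: G_invertible (rist_G (rist_level_res erefl (iL _ gg))).
Qed.

(* The double commutator trick: x := a r^-1 a^-1 r lies in M and agrees with a below w, so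
   [x, b] = [a, b]. *)
Lemma double_commutator (M B : set (seq nat -> seq nat)) r w a b :
  is_subgroup M -> is_subgroup B -> normalizes B M -> M r -> G r -> T w -> r w <> w ->
  B a -> B b -> rist T G w a -> rist T G w b -> M (comm a b).
Proof.
move=> hM hB nBM Mr Gr Tw rw Ba Bb ra rb.
have Ga := rist_G ra; have Gb := rist_G rb.
have [ia ib ir] := And3 (G_invertible Ga) (G_invertible Gb) (G_invertible Gr).
have rai := subgroupV (rist_subgroup w) ra; have rbi := subgroupV (rist_subgroup w) rb.
pose x := a \o inv r \o inv a \o r.
have Mx : M x.
  have -> : x = conj_by (inv a) (inv r) \o r by rewrite /conj_by (invI ia).
  by apply: subgroupM => //; apply: nBM; apply: subgroupV.
have ix := subgroup_invertible hM Mx.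
have xE z : prefix w z -> x z = a z.
  move=> pw; have [Tz|nTz] := pselect (T z); last first.
    by rewrite /x /= (aut_off Gr) // (aut_off (rist_G rai)) // (aut_off (subgroupV hG Gr)).
  rewrite /x /= (rist_fix rai) ?(invK1 ir) //.
  apply/negP => pw'; apply: rw; apply: eq_prefix_size (aut_prefix Gr Tz pw) pw' _.
  exact: aut_size.
have xN z : ~~ prefix w z -> ~~ prefix w (x z).
  apply: contra => pw; have pw' := rist_prefix rai pw.
  suff -> : z = inv a (x z) by [].
  by apply: (can_inj (invK1 ix)); rewrite (xE _ pw') (invK2 ia).
suff -> : comm a b = inv x \o conj_by b x by apply: subgroupVl => //; apply: nBM.
apply: funext => z; apply: (can_inj (invK1 ix)); rewrite /comm /conj_by /= (invK2 ix).
have [pw|nw] := boolP (prefix w z).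
  have pb := rist_prefix rb pw; have pba := rist_prefix rbi (rist_prefix ra pb).
  by rewrite (xE _ (rist_prefix rai pba)) (invK2 ia) (xE _ pb).
rewrite (rist_fix rb nw) (rist_fix ra nw) (rist_fix rbi nw) (rist_fix rai nw).
by rewrite (rist_fix rbi) // xN.
Qed.

(** * Branch groups acting on a space *)

Hypothesis transG : level_transitive T G.
Hypothesis fiG : forall n, (0 < n)%N -> finite_index (rist_level T G n) G.

(* Otherwise the orbit of xi under G is finite, so its points are separated at some level j, and a
   nontrivial element of the rigid stabilizer of xi|j moves a vertex w below xi|j; but w and its
   image are both prefixes of translates of xi passing through xi|j, that is, of xi. *)
Lemma finite_index_rist_moves xi n K : is_ray T xi -> (0 < n)%N ->
  (forall u, T u -> exists2 g, rist T G u g & g <> id) ->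
  is_subgroup K -> K `<=` rist T G (mkseq xi n) -> finite_index K (rist T G (mkseq xi n)) ->
  exists2 k, K k & ray_act k xi <> xi.
Proof.
move=> xiT n0 nontriv hK KR [s [sR sK]]; apply: contrapT => nomove.
have Kxi k : K k -> ray_act k xi = xi.
  by move=> Kk; apply: contrapT => ne; apply: nomove; exists k.
have [t [tG tL]] := fiG n0.
pose l := [seq ray_act (a \o b) xi | a <- t, b <- s].
have orbit g : G g -> ray_act g xi \in l.
  move=> Gg; have [a [h [ta [Lh ->]]]] := tL _ Gg.
  have Gh := rist_level_sub Lh; have Ga := tG _ ta.
  have rh : rist T G (mkseq xi n) (res (mkseq xi n) h).
    by apply: rist_level_res Lh; rewrite // size_mkseq.
  have [b [k [sb [Kk e]]]] := sK _ rh.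
  have Gb := rist_G (sR _ sb); have Gk := rist_G (KR _ Kk).
  (* On [xi] the element [h] acts as its component at xi|n, which is [b] times an element of [K],
     and [K] fixes [xi]. *)
  have eh : ray_act h xi = ray_act b xi.
    rewrite -[in RHS](Kxi k Kk) -(ray_act_comp Gb Gk xiT).
    apply: eq_from_mkseq => m; rewrite -e.
    rewrite -(take_mkseq (ray_act h xi) (leq_maxr n m)).
    rewrite -(take_mkseq (ray_act (res _ h) xi) (leq_maxr n m)).
    rewrite (ray_actE _ Gh xiT) (ray_actE _ (rist_G rh) xiT) /res.
    by rewrite prefix_mkseq // leq_maxl.
  rewrite (ray_act_comp Ga Gh xiT) eh.
  rewrite -(ray_act_comp Ga Gb xiT).
  by apply/allpairsP; exists (a, b); split=> //=; apply/InP.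
have [j sep] := separate_ray l xi.
have [h rh hid] := nontriv _ (xiT j).
have through w : T w -> prefix (mkseq xi j) w -> w = mkseq xi (size w).
  move=> Tw pw; have [g [Gg gw]] := transG (xiT (size w)) Tw (size_mkseq _ _).
  have jw : (j <= size w)%N by move: (size_prefix pw); rewrite size_mkseq.
  suff <- : ray_act g xi = xi by rewrite (ray_actE _ Gg xiT).
  apply: sep; first exact: orbit.
  rewrite -(take_mkseq _ jw) (ray_actE _ Gg xiT) gw.
  by move: pw; rewrite prefixE size_mkseq => /eqP.
apply: hid; apply: funext => w.
have Gh := rist_G rh.
have [Tw|nTw] := pselect (T w); last exact: aut_off _ nTw.
have [pw|npw] := boolP (prefix (mkseq xi j) w); last exact: rist_fix rh npw.
rewrite (through (h w)) ?(aut_size _ Gh) -?through //; first exact: aut_in.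
exact: rist_prefix pw.
Qed.

Hypothesis fgG : finitely_generated G.
Variables (X : topologicalType) (H : set (X -> X)) (S : seq (X -> X)).
Variable rho : (seq nat -> seq nat) -> (X -> X).
Hypotheses (hH : is_subgroup H) (contH : forall f, H f -> continuous f).
Hypothesis genS : fin_sym_gen H S.
Hypothesis rhoH : forall g, G g -> H (rho g).
Hypothesis rhoM : forall g h, G g -> G h -> rho (g \o h) = rho g \o rho h.

Let rho1 : rho id = id := rho_id hG hH rhoH rhoM.

Lemma rist_fg v : T v -> (0 < size v)%N -> finitely_generated (rist T G v).
Proof. by move=> Tv v0; apply: rist_finitely_generated => //; apply: fiG. Qed.

Definition fixing (V : set X) := [set g | G g /\ forall z : X, V z -> rho g z = z].

Lemma fixing_subgroup V : is_subgroup (fixing V).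
Proof.
apply: subgroupP => [|g h [Gg fg] [Gh fh]|g [/(subgroup_invertible hG)]//|g [Gg fg]].
- by split=> [|z _]; [apply: subgroup_id|rewrite rho1].
- by split=> [|z Vz]; [apply: subgroupM|rewrite rhoM //= fh // fg].
- split=> [|z Vz]; first exact: subgroupV.
  by rewrite (rhoV hG hH rhoH rhoM Gg) -{1}(fg z Vz) (invK1 (rho_inv_pair hH rhoH Gg)).
Qed.

Lemma finite_nbhs (I : Type) (s : seq I) (Q : I -> set X) (y : X) :
  (forall i, List.In i s -> nbhs y (Q i)) -> nbhs y [set z : X | forall i, List.In i s -> Q i z].
Proof.
elim: s => [|i s IH] hs; first by apply: nearW => z i [].
apply: filterS (filterI (hs i (or_introl erefl)) (IH (fun j sj => hs j (or_intror sj)))).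
by move=> z [Qi Qs] j [<-|/Qs].
Qed.

Lemma not_suppP (K : set (seq nat -> seq nat)) (y : X) : K `<=` G ->
  ~ supp_X (rho @` K) y <-> exists2 V, nbhs y V & K `<=` fixing V.
Proof.
move=> KG; split=> [ns|[V yV KV]].
  apply: contrapT => n; apply: ns => B yB; apply: contrapT => nB; apply: n; exists B => // g Kg.
  split; first exact: KG.
  move=> z Bz; apply: contrapT => ne; apply: nB; exists z; split=> //.
  by exists (rho g); split=> //; exists g.
move=> /(_ V yV) [z [[_ [[g Kg <-] ne] Vz]]]; apply: ne.
by have [_ ->] := KV _ Kg.
Qed.

(** The value at [y] of the map [q]. *)
Definition limit_rays (y : X) : set (nat -> nat) :=
  [set xi | is_ray T xi /\ forall n, supp_X (rho @` derived (rist T G (mkseq xi n))) y].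

Lemma derived_rist_G v : derived (rist T G v) `<=` G.
Proof.
move=> g /(derived_sub (rist_subgroup v)); exact: rist_G.
Qed.

(** By level transitivity, a trivial Rist(u) would make the rigid stabilizer of the prefix of [xi]
    of the same length trivial, and the trivial group has empty support. *)
Lemma limit_rays_nontriv (y : X) xi : limit_rays y xi ->
  forall u, T u -> exists2 g, rist T G u g & g <> id.
Proof.
move=> [xiT supp] u Tu; apply: contrapT => n.
have triv g : rist T G u g -> g = id.
  by move=> rg; apply: contrapT => ne; apply: n; exists g.
have [g [Gg gu]] := transG (xiT (size u)) Tu (size_mkseq _ _).
have trivxi h : rist T G (mkseq xi (size u)) h -> h = id.
  move=> rh; have := rist_conj Gg (xiT _) rh; rewrite gu => /triv e.
  have ig := subgroup_invertible hG Gg; apply: funext => w; apply: (can_inj (invK1 ig)).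
  by have := congr1 (fun f => f (g w)) e; rewrite /= (invK1 ig).
have : supp_X (rho @` derived (rist T G (mkseq xi (size u)))) y by apply: supp.
apply/not_suppP; first exact: derived_rist_G.
exists setT; first exact: filterT.
move=> g' /(derived_sub (rist_subgroup _)) /trivxi ->.
exact: subgroup_id (fixing_subgroup _).
Qed.

(** * Centralizers of a rigid stabilizer and stabilizers of germs *)

Section LocalCentralizers.
Variable v : seq nat.
Let R := rist T G v.

Definition centralizes (c : seq nat -> seq nat) := G c /\ forall r, R r -> commute r c.

(* [proj (germ_stab y)] is the P_i of the introduction. *)
Definition proj (L : set (seq nat -> seq nat)) :=
  [set a | R a /\ exists2 c, centralizes c & L (a \o c)].

Lemma proj_subgroup L : is_subgroup L -> is_subgroup (proj L).
Proof.
move=> hL; have hR : is_subgroup R by apply: rist_subgroup.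
apply: subgroupP => [|a b [Ra [c [Gc cR] Lac]] [Rb [e [Ge eR] Lbe]]|a [Ra _]|a [Ra [c [Gc cR] Lac]]].
- split; first exact: subgroup_id.
  by exists id; [split=> //; apply: subgroup_id|apply: subgroup_id].
- split; first exact: subgroupM.
  exists (c \o e); first by split=> [|r Rr]; [apply: subgroupM|apply: commute_comp; [apply: cR|apply: eR]].
  have -> : (a \o b) \o (c \o e) = (a \o c) \o (b \o e); last exact: subgroupM.
  by apply: funext => z; exact: (congr1 (fun f => a (f (e z))) (cR _ Rb)).
- exact: subgroup_invertible hR Ra.
- have [ia ic] := (subgroup_invertible hR Ra, subgroup_invertible hG Gc).
  split; first exact: subgroupV.
  exists (inv c); first by split=> [|r Rr]; [apply: subgroupV|apply: commuteV => //; apply: cR].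
  by rewrite -(invM ic ia) -(cR _ Ra); apply: subgroupV.
Qed.

(** On elements of [R], conjugation by [a] equals conjugation by [a \o c] when [c] centralizes [R],
    and a suitable such product lies in [M]. *)
Lemma proj_normalizes L M : L `<=` M -> is_subgroup M -> normalizes (proj L) (R `&` M).
Proof.
move=> LM hM a m [Ra [c [Gc cR] Lac]] [Rm Mm].
have hR : is_subgroup R by apply: rist_subgroup.
have Rc := subgroup_conj hR Ra Rm; split=> //.
have [ia ic] := (subgroup_invertible hR Ra, subgroup_invertible hG Gc).
have -> : conj_by a m = conj_by (a \o c) m.
  rewrite {2}/conj_by (invM ia ic); apply: funext => z.
  rewrite -[RHS]/(inv c ((conj_by a m \o c) z)) (cR _ Rc).
  by rewrite -[RHS]/(inv c (c (conj_by a m z))) (invK1 ic).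
by apply: subgroup_conj => //; apply: LM.
Qed.

End LocalCentralizers.

Definition germ_stab (y : X) := [set g | G g /\ H0 H y (rho g)].

Lemma germ_stab_subgroup (y : X) : is_subgroup (germ_stab y).
Proof.
apply: subgroupP => [|g h [Gg [Hg fg]] [Gh [Hh fh]]|g [/(subgroup_invertible hG)]//|g [Gg [Hg fg]]].
- split; first exact: subgroup_id.
  by rewrite rho1; split; [apply: subgroup_id|apply: nearW].
- split; first exact: subgroupM.
  rewrite rhoM //; split; first exact: subgroupM.
  by apply: filterS2 fg fh => z /= e1 e2; rewrite e2 e1.
- split; first exact: subgroupV.
  rewrite (rhoV hG hH rhoH rhoM Gg); split; first exact: subgroupV.
  by apply: filterS fg => z e; rewrite -{1}e (invK1 (rho_inv_pair hH rhoH Gg)).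
Qed.

Lemma mkseq_moves g xi n : G g -> is_ray T xi -> ray_act g xi <> xi ->
  exists2 m, (n <= m)%N & g (mkseq xi m) <> mkseq xi m.
Proof.
move=> Gg xiT /neq_mkseq [m ne]; exists (maxn n m); first exact: leq_maxl.
by rewrite -(ray_actE _ Gg xiT); apply: mkseq_neq ne; apply: leq_maxr.
Qed.

(** * Infinite index of the groups P_i *)

Section KeyPoint.
Variables (y : X) (xi : nat -> nat) (n d : nat).
Hypotheses (yxi : limit_rays y xi) (n0 : (0 < n)%N).
Hypothesis leud_d : forall k, leud_admits H S y k -> (k <= d)%N.
Let R := rist T G (mkseq xi n).
Let P := proj (mkseq xi n) (germ_stab y).

Let xiT : is_ray T xi := yxi.1.
Let hR : is_subgroup R := rist_subgroup _.
Let hP : is_subgroup P := proj_subgroup _ (germ_stab_subgroup y).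
Let PR : P `<=` R := fun a Pa => Pa.1.
Let nontriv := limit_rays_nontriv yxi.

Lemma rist_xi_mono i j : (i <= j)%N -> rist T G (mkseq xi j) `<=` rist T G (mkseq xi i).
Proof. by move=> ij; apply: rist_mono => //; apply: prefix_mkseq. Qed.

(** Let [a] move some xi|j, and let [b] in Rist(xi|j) move a longer prefix of [xi]. As [a] carries
    the subtree at xi|j off itself, the commutator acts on that prefix exactly as [b] does. *)
Lemma commutator_moves Q m : (0 < m)%N -> is_subgroup Q -> Q `<=` rist T G (mkseq xi m) ->
  finite_index Q (rist T G (mkseq xi m)) ->
  exists a b j, [/\ Q a, Q b, (m <= j)%N & comm a b (mkseq xi j) <> mkseq xi j].
Proof.
move=> m0 hQ QR fiQ; have hm := rist_subgroup (mkseq xi m).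
have [a Qa ne] := finite_index_rist_moves xiT m0 nontriv hQ QR fiQ.
have Ga := rist_G (QR _ Qa).
have [j mj aj] := mkseq_moves m Ga xiT ne.
have hj := rist_subgroup (mkseq xi j).
have fij := finite_indexI hQ hm hj QR (rist_xi_mono mj) fiQ.
have [b [Qb rb] neb] := finite_index_rist_moves xiT (leq_trans m0 mj)
  nontriv (subgroupI hQ hj) (fun g Qg => Qg.2) fij.
have Gb := rist_G rb; have [i ji bi] := mkseq_moves j Gb xiT neb.
exists a, b, i; split=> //; first exact: leq_trans ji.
have ia := subgroup_invertible hG Ga.
have pb := rist_prefix rb (prefix_mkseq xi ji).
rewrite /comm /= (rist_fix (subgroupV hj rb)) ?(invK1 ia) //.
apply/negP => p; apply: aj.
apply: eq_prefix_size (aut_prefix Ga _ pb) p _; first exact: aut_in.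
by rewrite (aut_size _ Ga).
Qed.

(** Suppose [r] moves xi|j. The group [M] contains [r] and is normalized by [N], so a first double
    commutator puts the derived group of [Q] into [M]. That derived group is normalized by all of
    Rist(xi|j) and contains an element moving some xi|i, so a second one puts Rist(xi|i)' into it.
    Hence Rist(xi|i)' acts trivially on [W]. *)
Lemma limit_ray_no_germ N V r : is_subgroup N -> normalizes R N -> N `<=` R -> finite_index N R ->
  nbhs y V -> N `<=` proj (mkseq xi n) (fixing V) ->
  R r -> germ_stab y r -> ray_act r xi = xi.
Proof.
move=> hN nRN NR fiN yV NV Rr [Gr [_ ry]]; apply: contrapT => ne.
pose W := V `&` [set z : X | rho r z = z].
have yW : nbhs y W by apply: filterI.
pose M := R `&` fixing W.
have hM : is_subgroup M := subgroupI hR (fixing_subgroup W).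
have Mr : M r by split=> //; split=> // z [].
have nNM : normalizes N M.
  move=> a m Na Mm; apply: (@proj_normalizes _ (fixing V)) (NV _ Na) Mm.
    by move=> g [Gg fg]; split=> // z [/fg].
  exact: fixing_subgroup.
have [j nj rj] := mkseq_moves n Gr xiT ne.
have Rj := rist_xi_mono nj.
have hj := rist_subgroup (mkseq xi j).
pose Q := N `&` rist T G (mkseq xi j).
have hQ : is_subgroup Q := subgroupI hN hj.
have QM : derived Q `<=` M.
  apply: derived_sub_of => // a b [Na ra] [Nb rb].
  exact: double_commutator hM hN nNM Mr Gr (xiT j) rj Na Nb ra rb.
have fiQ : finite_index Q (rist T G (mkseq xi j)) by apply: finite_indexI fiN.
have [a [b [i [Qa Qb ji ei]]]] := commutator_moves (leq_trans n0 nj) hQ (fun g Qg => Qg.2) fiQ.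
have De := derived_comm hQ Qa Qb.
have nQ : normalizes (rist T G (mkseq xi j)) (derived Q).
  apply: derived_normalizes => // c q rc [Nq rq]; split; last exact: subgroup_conj.
  by apply: nRN => //; apply: Rj.
have : supp_X (rho @` derived (rist T G (mkseq xi i))) y by apply: yxi.2.
apply/not_suppP; first exact: derived_rist_G.
exists W => //; suff sub : derived (rist T G (mkseq xi i)) `<=` M by move=> g /sub [].
apply: derived_sub_of => //; first exact: rist_subgroup.
move=> g h rg rh; apply: QM.
have Ge := rist_G (derived_sub hQ De).2.
exact: double_commutator (derived_subgroup hQ) hj nQ De Ge (xiT i) ei
  (rist_xi_mono ji rg) (rist_xi_mono ji rh) rg rh.
Qed.

Lemma infinite_index_proj : ~ finite_index P R.
Proof.
move=> fiP.
have [N [hN NP nRN fiN]] := finite_index_core hP hR PR fiP.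
have NR : N `<=` R by move=> g /NP/PR.
have fgR : finitely_generated R by apply: rist_fg; rewrite ?size_mkseq.
have [s [sN Ns]] := finitely_generated_finite_index hN hR NR fiN fgR.
have cs p : exists c, List.In p s -> centralizes (mkseq xi n) c /\ germ_stab y (p \o c).
  have [sp|nsp] := pselect (List.In p s); last by exists id => /nsp.
  by have [_ [c cc Lc]] := NP _ (sN _ sp); exists c.
have [c hc] := choice cs.
pose V := [set z : X | forall p, List.In p s -> rho (p \o c p) z = z].
have yV : nbhs y V.
  by apply: finite_nbhs => p /hc [_ [_ [_ ?]]].
(* Membership in the right-hand side is a subgroup condition, so the generators of [N] suffice. *)
have NV : N `<=` proj (mkseq xi n) (fixing V).
  move=> p /Ns; apply: gen_min; first exact/proj_subgroup/fixing_subgroup.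
  move=> q sq; have [cq [Gq _]] := hc _ sq; split; first exact/NR/sN.
  by exists (c q) => //; split=> // z; apply.
have germ_fix r : R r -> germ_stab y r -> ray_act r xi = xi.
  exact: limit_ray_no_germ hN nRN NR fiN yV NV.
(* If the orbit of [xi] under [P] were finite, so would be its orbit under [R]. The stabilizer of
   [xi] in [R] would then have finite index, which [finite_index_rist_moves] excludes. *)
have [[eta inj_eta etaP]|[l _ hl]] :=
    family_or_cover [set eta | exists2 p, P p & eta = ray_act p xi] d.+1; last first.
  pose K := [set g | R g /\ ray_act g xi = xi].
  have RG g : R g -> G g by apply: rist_G.
  have hK : is_subgroup K.
    apply: subgroupP => [|g h [Rg eg] [Rh eh]|g [Rg _]|g [Rg eg]].
    - by split; [apply: subgroup_id|apply: ray_act_id].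
    - split; first exact: subgroupM.
      by rewrite (ray_act_comp (RG _ Rg) (RG _ Rh) xiT) eh eg.
    - exact: subgroup_invertible hR Rg.
    - split; first exact: subgroupV.
      by rewrite -{1}eg (ray_actK (RG _ Rg) xiT).
  have [t [tR tP]] := fiP.
  pose l' := [seq ray_act a eta | a <- t, eta <- l].
  have Rl' g : R g -> ray_act g xi \in l'.
    move=> /tP [a [p [ta [Pp ->]]]].
    rewrite (ray_act_comp (RG _ (tR _ ta)) (RG _ (PR Pp)) xiT).
    apply/allpairsP; exists (a, ray_act p xi); split=> //=; first exact/InP.
    by apply/hl; exists p.
  have fiK : finite_index K R.
    apply: (@finite_index_of_invariant _ 'I_(size l').+1 (fun g => inord (index (ray_act g xi) l'))) => //.
    move=> g h Rg Rh /(congr1 (@nat_of_ord _)); rewrite !inordK ?ltnS ?index_size // => e.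
    have {}e : ray_act g xi = ray_act h xi.
      by rewrite -(nth_index xi (Rl' _ Rg)) e nth_index ?Rl'.
    split; first exact: subgroupVl.
    rewrite (ray_act_comp (subgroupV hG (RG _ Rg)) (RG _ Rh) xiT) -e.
    by rewrite (ray_actK (RG _ Rg) xiT).
  have [k [_ ek]] := finite_index_rist_moves xiT n0 nontriv hK
    (fun g Kg => Kg.1) fiK.
  exact.
have etaP2 i : exists p, P p /\ eta i = ray_act p xi.
  by have [p Pp e] := etaP i; exists p.
have [p hp] := choice etaP2.
have Pp i : P (p i) by have [] := hp i.
have Gp i : G (p i) by have [? _] := hp i; apply: rist_G (PR _).
have etaT i : is_ray T (eta i).
  by have [_ ->] := hp i; apply: is_ray_act.
have [m nm sep] := separate_rays n inj_eta.
have m0 : (0 < m)%N := leq_trans n0 nm.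
pose u i := mkseq (eta i) m.
pose B i := rist T G (u i).
(* Since [p i] fixes xi|n, the ray [eta i] still passes through that vertex. *)
have BR i : B i `<=` R.
  apply: rist_mono; rewrite /u; have [_ ->] := hp i; rewrite ray_actE //.
  by rewrite -(rist_base (PR (Pp i))); apply: aut_prefix => //; apply: prefix_mkseq.
pose C i := [set b | B i b /\ ray_act b (eta i) = eta i].
have hB i : is_subgroup (B i) by apply: rist_subgroup.
have BG i : B i `<=` G by apply: rist_G.
have commB i j (g h : seq nat -> seq nat) : i != j -> B i g -> B j h -> commute g h.
  by move=> /sep ij; apply: rist_commute; rewrite ?size_mkseq.
have hC i : is_subgroup (C i).
  apply: subgroupP => [|g h [Bg eg] [Bh eh]|g [Bg _]|g [Bg eg]].
  - by split; [apply: subgroup_id|apply: ray_act_id].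
  - split; first exact: subgroupM.
    by rewrite (ray_act_comp (BG _ _ Bg) (BG _ _ Bh) (etaT i)) eh eg.
  - exact: subgroup_invertible (hB i) Bg.
  - split; first exact: subgroupV.
    by rewrite -{1}eg (ray_actK (BG _ _ Bg) (etaT i)).
have CB i : C i `<=` B i by move=> b [].
have infC i : ~ finite_index (C i) (B i).
  move=> fiC; have [b [_ eb]] := finite_index_rist_moves (etaT i) m0 nontriv (hC i) (@CB i) fiC.
  exact.
have fgB i : finitely_generated (B i) by apply: rist_fg; rewrite ?size_mkseq //; apply: etaT.
suff admits : leud_admits H S y d.+1 by have := leud_d admits; rewrite ltnn.
apply: (leud_lower_bound hG hH genS rhoH rhoM hB BG fgB commB hC CB infC) => b Bb germ i.
split=> //; have Gb j : G (b j) by apply: BG (Bb j).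
set prod := prodf b _ in germ.
have Rprod : R prod.
  apply: prodf_ind => [|g h|j _]; [exact: subgroup_id|exact: subgroupM|exact: BR (Bb j)].
have Gprod := rist_G Rprod.
have Lprod : germ_stab y prod by split.
(* The conjugate of [prod] by [p i] again lies in [R] and stabilizes the germ, so it fixes [xi];
   hence [prod] fixes the translate [eta i]. *)
have [Rc Lc] := proj_normalizes (@subset_refl _ _) (germ_stab_subgroup y) (Pp i) (conj Rprod Lprod).
have Gc := rist_G Rc; have ip := subgroup_invertible hG (Gp i).
have fix_eta : ray_act prod (eta i) = eta i.
  have [_ ei] := hp i; rewrite {2}ei -(germ_fix _ Rc Lc) -(ray_act_comp (Gp i) Gc xiT).
  have -> : p i \o conj_by (p i) prod = prod \o p i.
    by apply: funext => z; rewrite /conj_by /= (invK2 ip).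
  by rewrite (ray_act_comp Gprod (Gp i) xiT) -ei.
(* At depth at least [m] the factors other than [b i] fix the prefixes of [eta i], so [b i] acts on
   them as [prod] does. *)
apply: eq_from_mkseq => j; rewrite -[in RHS]fix_eta.
rewrite -!(take_mkseq _ (leq_maxl j m)) !ray_actE //; congr take.
rewrite /prod (prodf_split (index_enum_uniq _) (mem_index_enum i)); last first.
  by move=> a a' _ _ aa'; apply: commB aa' _ _.
congr (b i _); symmetry.
apply: (prodf_ind (K := [set g | g (mkseq (eta i) (maxn j m)) = mkseq (eta i) (maxn j m)])) => //.
  by move=> g h /= eg eh; rewrite eh eg.
move=> a _; case: eqVneq => [//|ai]; apply: rist_fix (Bb a) _; apply/negP => pa.
apply: (sep _ _ ai); apply: eq_prefix_size pa _ _; last by rewrite !size_mkseq.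
by apply: prefix_mkseq; apply: leq_maxr.
Qed.

End KeyPoint.

(** * Number and existence of limit rays *)

Section Cardinality.
Variables (y : X) (d : nat).
Hypothesis leud_d : forall k, leud_admits H S y k -> (k <= d)%N.

(** If a product of elements [b j] stabilizes the germ at [y], the product of the factors with [j]
    different from [i] is the centralizing element that puts [b i] into [C i]. The lower bound then
    applies because each [C i] has infinite index. *)
Lemma limit_rays_card k (eta : 'I_k -> nat -> nat) : injective eta ->
  (forall i, limit_rays y (eta i)) -> (k <= d)%N.
Proof.
move=> inj_eta etaY; apply: leud_d.
have etaT i : is_ray T (eta i) := (etaY i).1.
(* The level is at least 1, where [fiG] gives finite index. *)
have [m m0 sep] := separate_rays 1 inj_eta.
pose u i := mkseq (eta i) m; pose B i := rist T G (u i).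
have hB i : is_subgroup (B i) by apply: rist_subgroup.
have BG i : B i `<=` G by apply: rist_G.
have commB i j (g h : seq nat -> seq nat) : i != j -> B i g -> B j h -> commute g h.
  by move=> /sep ij; apply: rist_commute; rewrite ?size_mkseq.
pose C i := proj (u i) (germ_stab y).
have hC i : is_subgroup (C i) by apply/proj_subgroup/germ_stab_subgroup.
have CB i : C i `<=` B i by move=> b [].
have infC i : ~ finite_index (C i) (B i) by apply: infinite_index_proj leud_d.
have fgB i : finitely_generated (B i) by apply: rist_fg; rewrite ?size_mkseq //; apply: etaT.
apply: (leud_lower_bound hG hH genS rhoH rhoM hB BG fgB commB hC CB infC) => b Bb germ i.
have Gb j : G (b j) by apply: BG (Bb j).
rewrite (prodf_split (index_enum_uniq _) (mem_index_enum i)) in germ; last first.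
  by move=> a c _ _ ac; apply: commB ac _ _.
split; first exact: Bb.
set c := prodf _ _ in germ; have Gc : G c.
  apply: prodf_ind => [|g h|j _]; [exact: subgroup_id|exact: subgroupM|].
  by case: eqP => // _; apply: subgroup_id.
exists c; last by split=> //; apply: subgroupM.
split=> // r Br; apply: commute_prodf => j _; case: eqVneq => // ji.
have ij : i != j by rewrite eq_sym.
exact: commB ij Br (Bb j).
Qed.

Lemma supp_mono v w : prefix v w -> supp_X (rho @` derived (rist T G w)) y ->
  supp_X (rho @` derived (rist T G v)) y.
Proof.
move=> pvw; apply: closure_subset => x [f [[g Dg <-] ne]]; exists (rho g); split=> //.
by exists g => //; apply: derived_mono Dg; apply: rist_mono.
Qed.

Lemma limit_rays_nonempty : ess_supp T G rho y -> exists xi, limit_rays y xi.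
Proof.
move=> Yy; pose T' := [set v | T v /\ supp_X (rho @` derived (rist T G v)) y].
have T'take v w : prefix v w -> T' w -> T' v.
  by move=> p [Tw /(supp_mono p)]; split=> //; apply: tree_prefix p.
(* If no vertex of level [n] qualified, the intersection of finitely many neighbourhoods of [y]
   would be fixed pointwise by Rist(n)'. *)
have level n : (0 < n)%N -> exists2 v, T' v & size v = n.
  move=> n0; apply: contrapT => none; have := Yy n n0.
  apply/not_suppP; first by move=> g /(derived_sub (rist_level_subgroup n)); apply: rist_level_sub.
  have [s hs] := level_finite rootT lfT n.
  have hV v : exists V, nbhs y V /\ (T v -> size v = n -> derived (rist T G v) `<=` fixing V).
    have [[Tv sv]|nv] := pselect (T v /\ size v = n); last first.
      by exists setT; split=> [|Tv sv]; [apply: filterT|case: nv].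
    have : ~ supp_X (rho @` derived (rist T G v)) y by move=> sup; apply: none; exists v.
    by move/not_suppP => [|V yV fV]; [exact: derived_rist_G|exists V].
  have [V VP] := choice hV.
  exists [set z | forall v, List.In v s -> V v z].
    by apply: finite_nbhs => v _; have [] := VP v.
  apply: derived_rist_level => [|v Tv sv g Dg]; first exact: fixing_subgroup.
  have [_ /(_ Tv sv) /(_ g Dg) [Gg fg]] := VP v; split=> // z Vz; apply: fg; apply: Vz.
  by apply/InP/hs.
(* Level 0 does not enter the essential support, so the root is obtained as a prefix of a vertex of
   level 1. *)
have rootT' : is_rooted_tree T'.
  split=> [|v i]; last by apply: T'take; apply: prefix_rcons.
  by have [v T'v _] := level 1%N isT; apply: T'take T'v; apply: prefix0s.
have [||xi xiT'] := konig rootT'.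
- by move=> v [Tv _]; have [b hb] := lfT Tv; exists b => i [/hb].
- move=> [s hs]; have [v T'v sv] := level (\max_(v <- s) size v).+1 isT.
  have := leq_bigmax_seq (F := size) (P := xpredT) _ (hs _ T'v) isT.
  by rewrite sv ltnn.
by exists xi; split=> n; have [] := xiT' n.
Qed.

Lemma limit_rays_bd_pow : ess_supp T G rho y -> in_bd_pow T d (limit_rays y).
Proof.
move=> /limit_rays_nonempty [xi qxi].
have [[eta inj_eta etaY]|[l sl hl]] := family_or_cover (limit_rays y) d.+1.
  by have := limit_rays_card inj_eta etaY; rewrite ltnn.
exists l; split; first by case: l {sl} hl => // /(_ xi) [/(_ qxi)].
split=> //; split; first by move=> eta /InP /hl [].
by apply/seteqP; split=> eta; [move/hl/InP|move/InP/hl].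
Qed.

End Cardinality.

(** * Equivariance, upper semi-continuity and continuity *)

Lemma limit_rays_act g y xi : G g -> limit_rays y xi -> limit_rays (rho g y) (ray_act g xi).
Proof.
move=> Gg [xiT supp]; split=> [|n]; first exact: is_ray_act.
rewrite ray_actE // => B yB.
have /(supp n) [x [[_ [[k Dk <-] ne]] Bx]] : nbhs y (rho g @^-1` B).
  exact: (contH (rhoH Gg)) yB.
have ig := subgroup_invertible hG Gg; have irg := rho_inv_pair hH rhoH Gg.
have Gi := subgroupV hG Gg; have Gk := derived_rist_G Dk.
(* The point [x] near [y] moved by [k] is carried to a point near [rho g y] moved by the conjugate
   of [k], which lies in the derived rigid stabilizer of the image vertex. *)
exists (rho g x); split=> //; exists (rho (g \o k \o inv g)); split.
  exists (g \o k \o inv g) => //.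
  have -> : g \o k \o inv g = conj_by (inv g) k by rewrite /conj_by (invI ig).
  apply: (derived_conj (invertible_inv ig) (rist_subgroup _) (rist_subgroup _)) Dk => h rh.
  by rewrite /conj_by (invI ig); apply: rist_conj.
have Ggk := subgroupM hG Gg Gk.
rewrite (rhoM Ggk Gi) (rhoM Gg Gk) (rhoV hG hH rhoH rhoM Gg) /= (invK1 irg).
by move/(can_inj (invK1 irg)).
Qed.

Lemma limit_rays_equivariant g y : G g -> limit_rays (rho g y) = ray_act g @` limit_rays y.
Proof.
move=> Gg; have Gi := subgroupV hG Gg; have ig := subgroup_invertible hG Gg.
apply/seteqP; split=> [xi qxi|_ [xi qxi <-]]; last exact: limit_rays_act.
exists (ray_act (inv g) xi).
  have := limit_rays_act Gi qxi.
  by rewrite (rhoV hG hH rhoH rhoM Gg) (invK1 (rho_inv_pair hH rhoH Gg)).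
by have := ray_actK Gi qxi.1; rewrite (invI ig).
Qed.

(** Consider the tree of prefixes [v] of rays in [K] for which [y] lies in the support of Rist(v)'.
    If it were infinite, Koenig's lemma and closedness of [K] would give a limit ray of [y] in [K].
    Hence it has no vertex at some level, and the finitely many closed supports there all miss a
    neighbourhood of [y]. *)
Lemma limit_rays_usc Y : usc T Y limit_rays.
Proof.
move=> K [KT Kclosed]; exists [set y | limit_rays y `&` K = set0].
split; last by apply/seteqP; split=> y [].
rewrite openE => y qyK.
pose on_K v := exists2 eta, K eta & mkseq eta (size v) = v.
pose T' := [set v | [/\ T v, on_K v & supp_X (rho @` derived (rist T G v)) y]].
have nofin : ~ infinite_tree T'.
  move=> infT'.
  have T'take v w : prefix v w -> T' w -> T' v.
    move=> p [Tw [eta Keta e] /(supp_mono p)]; split=> //; first exact: tree_prefix p.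
    have le := size_prefix p; exists eta => //.
    by move: p; rewrite prefixE -{1}e (take_mkseq _ le) => /eqP.
  have rootT' : is_rooted_tree T'.
    split=> [|v i]; last by apply: T'take; apply: prefix_rcons.
    apply: contrapT => n0; apply: infT'; exists [::] => v T'v.
    by case: n0; apply: T'take T'v; apply: prefix0s.
  have [|xi xiT'] := konig rootT' _ infT'.
    by move=> v [Tv _ _]; have [b hb] := lfT Tv; exists b => i [/hb].
  have xiT : is_ray T xi by move=> n; have [] := xiT' n.
  suff : (limit_rays y `&` K) xi by rewrite qyK.
  split; first by split=> // n; have [] := xiT' n.
  apply: contrapT => /(Kclosed _ xiT) [n hn]; have [_ [eta Keta]] := xiT' n.
  by rewrite size_mkseq => e _; apply: hn e.
have [s hs] : exists s : seq (seq nat), forall v, T' v -> v \in s by apply: contrapT.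
(* One level beyond the longest vertex of the finite tree [T']. *)
pose n := (\max_(v <- s) size v).+1.
have [vs hvs] := level_finite rootT lfT n.
have nT' v : size v = n -> ~ T' v.
  move=> sv /hs vs'; have := leq_bigmax_seq (F := size) (P := xpredT) _ vs' isT.
  by rewrite sv ltnn.
have near_y : nbhs y [set z | forall v, List.In v vs ->
    T v /\ size v = n /\ on_K v -> ~ supp_X (rho @` derived (rist T G v)) z].
  apply: finite_nbhs => v _.
  have [[Tv [sv Kv]]|nv] := pselect (T v /\ size v = n /\ on_K v); last first.
    by apply: nearW => z /nv.
  have nsupp : ~ supp_X (rho @` derived (rist T G v)) y by move=> sup; apply: (nT' v sv).
  have : nbhs y (~` supp_X (rho @` derived (rist T G v))).
    by apply: open_nbhs_nbhs; split=> //; apply/closed_openC/closed_closure.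
  by apply: filterS => z nz _.
apply: filterS near_y => z hz; apply/seteqP; split=> // eta [[etaT supp] Keta].
apply: (hz (mkseq eta n)) (supp n); first by apply/InP/hvs; rewrite ?size_mkseq.
by split=> //; split; [rewrite size_mkseq|exists eta; rewrite ?size_mkseq].
Qed.

(** Semi-continuity is applied to the closed set of rays that leave [xi] before depth [n]; when the
    values are singletons, avoiding this set means sharing the prefix of length [n]. *)
Lemma limit_rays_continuous Y : (forall y, Y y -> in_bd_pow T 1 (limit_rays y)) ->
  cont_bd Y limit_rays.
Proof.
move=> Y1 y xi n Yy qxi.
pose K := [set eta | is_ray T eta /\ mkseq eta n <> mkseq xi n].
have [|O [openO eO]] := @limit_rays_usc Y K.
  split=> [eta []//|eta etaT nK]; exists n => eta' [eta'T ne] e; apply: nK; split=> //.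
  by rewrite -e.
have single (x : X) eta : Y x -> limit_rays x eta -> forall eta', limit_rays x eta' -> eta' = eta.
  move=> /Y1 [[|a [|b l]] [_ [_ [_ ->]]]] //= [<-|[]] eta' //.
  by case=> [->|[]].
exists O; split=> //.
have Oy : [set y | Y y /\ limit_rays y `&` K = set0] y.
  split=> //; apply/seteqP; split=> // eta [qeta [_ ne]]; apply: ne.
  by rewrite (single _ _ Yy qxi _ qeta).
split; first by move: Oy; rewrite eO => -[].
move=> z eta Oz Yz qeta; apply: contrapT => ne.
have : [set y | Y y /\ limit_rays y `&` K = set0] z by rewrite eO.
move=> [_ e]; have : (limit_rays z `&` K) eta by split=> //; split=> //; exact: qeta.1.
by rewrite e.
Qed.

End BranchAction.

Theorem theorem6p24 (Tv : set (seq nat)) (G : set (seq nat -> seq nat))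
  (X : topologicalType) (H : set (X -> X)) (S : list (X -> X)) (d : nat)
  (rho : (seq nat -> seq nat) -> (X -> X)) :
  is_rooted_tree Tv -> locally_finite Tv -> infinite_tree Tv ->
  is_branch Tv G -> fin_gen G ->
  compact [set: X] ->
  is_homeo_group H -> fin_sym_gen H S -> sup_leud_eq H S d ->
  (forall g, G g -> H (rho g)) ->
  (forall g h, G g -> G h -> rho (g \o h) = rho g \o rho h) ->
  (forall g h, G g -> G h -> rho g = rho h -> g = h) ->
  exists q : X -> set (nat -> nat),
    (forall y, ess_supp Tv G rho y -> in_bd_pow Tv d (q y)) /\
    usc Tv (ess_supp Tv G rho) q /\
    (forall g y, G g -> ess_supp Tv G rho y -> q (rho g y) = ray_act g @` q y) /\
    (d = 1%N -> cont_bd (ess_supp Tv G rho) q).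
Proof.
move=> rootT lfT _ [hG [autG [transG fiG]]] [_ fgG] _ [hH contH] genS [leud_d _] rhoH rhoM _.
have bd y : ess_supp Tv G rho y -> in_bd_pow Tv d (limit_rays Tv G rho y).
  exact: (limit_rays_bd_pow rootT lfT hG autG transG fiG fgG hH genS rhoH rhoM (leud_d y)).
exists (limit_rays Tv G rho); split=> //; split; first exact: limit_rays_usc.
split=> [g y Gg _|d1]; first exact: (limit_rays_equivariant rootT hG autG hH contH rhoH rhoM).
by rewrite d1 in bd; apply: limit_rays_continuous.
Qed.
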